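(* Let $L$ be a nilpotent Lie superalgebra with $\dim L=(m\mid n)$. Then $s(L)=1$ if and only if $L$ is isomorphic to one of $$L_{5,0}^2,\qquad A(1\mid 0),\qquad A(0\mid 1).$$
   Context: All Lie superalgebras are finite dimensional over $\mathbb{C}$. $\dim L=(m\mid n)$ means $\dim L_{\bar 0}=m$, $\dim L_{\bar 1}=n$. Isomorphisms are bijective even (degree-preserving) homomorphisms. $L$ is nilpotent if its descending central sequence $L^0=L$, $L^{k+1}=[L^k,L]$ reaches $0$. Schur multiplier: for a free presentation $0\to R\to F\to L\to 0$ with $F$ a free Lie superalgebra, $\mathcal M(L)=\frac{[F,F]\cap R}{[F,R]}$ (independent of the presentation up to isomorphism); $\dim\mathcal M(L)$ is its total dimension (even plus odd). For $\dim L=(m\mid n)$ define $s(L)=\frac12(m+n-2)(m+n-1)+n+1-\dim\mathcal M(L)$. $A(k\mid l)$ denotes the abelian Lie superalgebra of dimension $(k\mid l)$. $L_{5,0}^2$ is the $(5\mid 0)$-dimensional Lie superalgebra (a Lie algebra) with even basis $x_0,y_0,z_0,v_0,w_0$ and nonzero brackets (up to skew-symmetry) $[x_0,y_0]=v_0$, $[x_0,z_0]=w_0$. *)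

(* Defs.v *)
From mathcomp Require Import all_boot all_order all_algebra.
From mathcomp Require Import boolp classical_sets reals complex.

Set Implicit Arguments.
Unset Strict Implicit.
Unset Printing Implicit Defensive.

Import GRing.Theory.

Local Open Scope classical_set_scope.
Local Open Scope ring_scope.

Definition subspace (K : fieldType) (V : lmodType K) (A : set V) : Prop :=
  A 0 /\ forall (a : K) (x y : V), A x -> A y -> A (a *: x + y).

Definition linear_span (K : fieldType) (V : lmodType K) (S : set V) : set V :=
  smallest (@subspace K V) S.

(* dim (A / B) = d for subspaces B `<=` A: the classes of the e i form a basis
   of A / B. *)
Definition quot_dim (K : fieldType) (V : lmodType K) (A B : set V) (d : nat) :
    Prop :=
  exists e : 'I_d -> V,
    (forall i, A (e i)) /\
    (forall x, A x ->
       exists! c : 'rV[K]_d, B (x - \sum_(i < d) c ord0 i *: e i)).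

(* Parities are booleans: [false] is even, [true] is odd, and [a (+) b] is the
   sum in Z/2. In characteristic 2 or 3 the usual definition has further
   axioms, so the base field is restricted to characteristic 0. No dimension
   assumption is made, since free Lie superalgebras are infinite dimensional in
   general. *)
Record lieSuper (K : numFieldType) := LieSuper {
  carrier :> lmodType K;
  component : bool -> set carrier;
  bracket : carrier -> carrier -> carrier;
  component_subspace : forall a, subspace (component a);
  component_span : forall x : carrier,
    exists x0 x1, component false x0 /\ component true x1 /\ x = x0 + x1;
  component_direct : forall x : carrier,
    component false x -> component true x -> x = 0;
  bracket_linearl : forall y : carrier, linear (bracket^~ y);
  bracket_linearr : forall x : carrier, linear (bracket x);
  bracket_component : forall a b (x y : carrier),
    component a x -> component b y -> component (a (+) b) (bracket x y);
  bracket_skew : forall a b (x y : carrier), component a x -> component b y ->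
    bracket x y = - ((-1) ^+ (a && b) *: bracket y x);
  bracket_jacobi : forall a b (x y z : carrier),
    component a x -> component b y ->
    bracket x (bracket y z) =
      bracket (bracket x y) z + (-1) ^+ (a && b) *: bracket y (bracket x z)
}.

Arguments component {K} l _ _ : rename.
Arguments bracket {K} l _ _ : rename.

Definition is_hom (K : numFieldType) (L M : lieSuper K) (f : L -> M) : Prop :=
  linear f /\
  (forall a x, component L a x -> component M a (f x)) /\
  (forall x y, f (bracket L x y) = bracket M (f x) (f y)).

Definition isomorphic (K : numFieldType) (L M : lieSuper K) : Prop :=
  exists f : L -> M, is_hom f /\ bijective f.

Definition superdim (K : numFieldType) (L : lieSuper K) (m n : nat) : Prop :=
  quot_dim (component L false) [set 0] m /\
  quot_dim (component L true) [set 0] n.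

Definition bracket_space (K : numFieldType) (L : lieSuper K) (A B : set L) :
    set L :=
  linear_span [set bracket L x y | x in A & y in B].

Definition central_series (K : numFieldType) (L : lieSuper K) (k : nat) :
    set L :=
  iter k (fun A => bracket_space A setT) setT.

Arguments central_series {K} L _ _.

Definition lie_nilpotent (K : numFieldType) (L : lieSuper K) : Prop :=
  exists k, central_series L k = [set 0].

Definition is_free (K : numFieldType) (F : lieSuper K)
    (X : Type) (p : X -> bool) (i : X -> F) : Prop :=
  (forall x, component F (p x) (i x)) /\
  (forall (G : lieSuper K) (g : X -> G), (forall x, component G (p x) (g x)) ->
     exists! f : F -> G, is_hom f /\ forall x, f (i x) = g x).

(* A free presentation 0 -> R -> F -> L -> 0, given by the quotient map
   pi : F -> L, with R = ker pi. *)
Definition free_presentation (K : numFieldType) (L F : lieSuper K)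
    (pi : F -> L) : Prop :=
  (exists (X : Type) (p : X -> bool) (i : X -> F), is_free p i) /\
  is_hom pi /\ (forall y, exists x, pi x = y).

Definition kernel (K : numFieldType) (L F : lieSuper K) (pi : F -> L) : set F :=
  [set x | pi x = 0].

Definition presentation_multiplier_dim (K : numFieldType) (L F : lieSuper K)
    (pi : F -> L) (d : nat) : Prop :=
  quot_dim (bracket_space setT setT `&` kernel pi)
           (bracket_space setT (kernel pi)) d.

(* The total dimension of the Schur multiplier of L, which is finite and
   independent of the free presentation for L finite dimensional. The default
   value 0 is only returned if no presentation gives a finite dimension. *)
Definition multiplier_dim (K : numFieldType) (L : lieSuper K) : nat :=
  xget 0%N [set d | exists (F : lieSuper K) (pi : F -> L),
    free_presentation pi /\ presentation_multiplier_dim pi d].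

(* The invariant s(L) of L with dim L = (m | n); it is rational valued so that
   no subtraction is truncated. *)
Definition s_invariant (K : numFieldType) (L : lieSuper K) (m n : nat) : rat :=
  2^-1 * ((m + n)%:R - 2) * ((m + n)%:R - 1) + n%:R + 1
  - (multiplier_dim L)%:R.

Section Abelian.
Variables (K : numFieldType) (k l : nat).

Let V : lmodType K := ('rV[K]_k * 'rV[K]_l)%type.
Let cmp (a : bool) : set V :=
  if a then [set u | u.1 = 0] else [set u | u.2 = 0].
Let brk (_ _ : V) : V := 0.

Fact abelian_subspace a : subspace (cmp a).
Proof.
by case: a; split=> //= c x y /= hx hy; rewrite hx hy scaler0 addr0.
Qed.

Fact abelian_span (x : V) :
  exists x0 x1, cmp false x0 /\ cmp true x1 /\ x = x0 + x1.
Proof.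
exists (x.1, 0), (0, x.2); split=> //; split=> //.
by case: x => u v; congr pair; rewrite /= ?addr0 ?add0r.
Qed.

Fact abelian_direct (x : V) : cmp false x -> cmp true x -> x = 0.
Proof. by case: x => u v /= -> ->. Qed.

Fact abelian_linearl (y : V) : linear (brk^~ y).
Proof. by move=> c u v; rewrite /brk scaler0 addr0. Qed.

Fact abelian_linearr (x : V) : linear (brk x).
Proof. by move=> c u v; rewrite /brk scaler0 addr0. Qed.

Fact abelian_comp a b (x y : V) :
  cmp a x -> cmp b y -> cmp (a (+) b) (brk x y).
Proof. by move=> _ _; case: (abelian_subspace (a (+) b)). Qed.

Fact abelian_skew a b (x y : V) : cmp a x -> cmp b y ->
  brk x y = - ((-1) ^+ (a && b) *: brk y x).
Proof. by move=> _ _; rewrite /brk scaler0 oppr0. Qed.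

Fact abelian_jacobi a b (x y z : V) : cmp a x -> cmp b y ->
  brk x (brk y z) = brk (brk x y) z + (-1) ^+ (a && b) *: brk y (brk x z).
Proof. by move=> _ _; rewrite /brk scaler0 addr0. Qed.

Definition abelian_super : lieSuper K :=
  LieSuper abelian_subspace abelian_span abelian_direct abelian_linearl
    abelian_linearr abelian_comp abelian_skew abelian_jacobi.

End Abelian.

(* The coordinates 0, 1, 2, 3, 4 are those in the basis x_0, y_0, z_0, v_0, w_0;
   the nonzero brackets are [x_0, y_0] = v_0 and [x_0, z_0] = w_0. *)
Section L520.
Variable K : numFieldType.

Let V : lmodType K := 'rV[K]_5.
Let crd (x : V) (i : nat) : K := x ord0 (inord i).
Let bas (i : nat) : V := delta_mx ord0 (inord i).
Let cmp (a : bool) : set V := if a then [set 0] else setT.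
Let brk (x y : V) : V :=
  (crd x 0 * crd y 1 - crd x 1 * crd y 0) *: bas 3 +
  (crd x 0 * crd y 2 - crd x 2 * crd y 0) *: bas 4.

Let crdP a (x y : V) i : crd (a *: x + y) i = a * crd x i + crd y i.
Proof. by rewrite /crd !mxE. Qed.

Let crd_brk (x y : V) i : (i < 3)%N -> crd (brk x y) i = 0.
Proof.
move=> hi; rewrite /crd /brk /bas !mxE -!val_eqE /=.
by rewrite !inordK ?(ltn_trans hi) //; case: i hi => [|[|[|]]] //= _;
   rewrite !mulr0 addr0.
Qed.

Fact L520_subspace a : subspace (cmp a).
Proof.
by case: a; split=> //= c x y /= hx hy; rewrite hx hy scaler0 addr0.
Qed.

Fact L520_span (x : V) :
  exists x0 x1, cmp false x0 /\ cmp true x1 /\ x = x0 + x1.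
Proof. by exists x, 0; rewrite addr0. Qed.

Fact L520_direct (x : V) : cmp false x -> cmp true x -> x = 0.
Proof. by []. Qed.

Let brk_skew (x y : V) : brk x y = - brk y x.
Proof.
rewrite /brk opprD -!scaleNr !opprB.
by rewrite ![crd x _ * crd y _]mulrC.
Qed.

Fact L520_linearl (y : V) : linear (brk^~ y).
Proof.
move=> c u v; rewrite /brk !crdP scalerDr !scalerA addrACA -!scalerDl.
by congr (_ *: _ + _ *: _); rewrite !mulrDl mulrBr !mulrA opprD addrACA.
Qed.

Fact L520_linearr (x : V) : linear (brk x).
Proof.
move=> c u v; rewrite brk_skew L520_linearl opprD -scalerN.
by rewrite -!brk_skew.
Qed.

Fact L520_comp a b (x y : V) :
  cmp a x -> cmp b y -> cmp (a (+) b) (brk x y).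
Proof.
have h0 u : brk 0 u = 0.
  by rewrite /brk /crd !mxE !mul0r subrr !scale0r addr0.
case: a b => [] [] //= hx hy; first by rewrite hx h0.
by rewrite hy brk_skew h0 oppr0.
Qed.

Fact L520_skew a b (x y : V) : cmp a x -> cmp b y ->
  brk x y = - ((-1) ^+ (a && b) *: brk y x).
Proof.
case: a b => [] [] /= hx hy; rewrite ?expr0 ?scale1r -?brk_skew //.
by rewrite hx hy /brk /crd !mxE !mul0r subrr !scale0r addr0 scaler0 oppr0.
Qed.

Fact L520_jacobi a b (x y z : V) : cmp a x -> cmp b y ->
  brk x (brk y z) = brk (brk x y) z + (-1) ^+ (a && b) *: brk y (brk x z).
Proof.
have h0 u v w : brk u (brk v w) = 0.
  by rewrite {1}/brk !crd_brk // !mulr0 subrr !scale0r addr0.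
by move=> _ _; rewrite [brk (brk x y) z]brk_skew !h0 oppr0 scaler0 addr0.
Qed.

Definition L520 : lieSuper K :=
  LieSuper L520_subspace L520_span L520_direct L520_linearl
    L520_linearr L520_comp L520_skew L520_jacobi.

End L520.

(* Main.v *)
Require Import Defs.
From HB Require Import structures.
From mathcomp Require Import all_boot all_order all_algebra.
From mathcomp Require Import boolp classical_sets reals complex.
From mathcomp Require Import generic_quotient ring lra zify.

(* Write N for the total dimension of L and k for that of the derived subalgebra
   L'. Lifting a free presentation F -> L to the central extensions of L
   identifies the dual of [F, F] / [F, R] with the space Z of super-skew
   2-cocycles on L, so that dim M(L) = dim Z - k and s(L) is governed by dim Z.
   Adding one homogeneous element z of L', central modulo a graded ideal I, to I
   changes the dimension of the space Z_I of cocycles vanishing on I by the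
   dimension of the space of functionals f(z, -), f in Z_I, which annihilate L';
   when I + <z> = L' this dimension is at most 2. Summing up gives s(L) >= 3 for
   k >= 3, whereas s(L) is never 1 for k = 1 and s(L) = 2 - N for k = 0. If k = 2
   and s(L) = 1, all these bounds are attained: L' is even, the centre lies in
   L', and each nonzero functional on L' turns the bracket into a form of rank 2.
   Such an L is L_{5,0}^2. *)

Set Implicit Arguments.
Unset Strict Implicit.
Unset Printing Implicit Defensive.

Import Order.TTheory GRing.Theory Num.Theory.

Local Open Scope classical_set_scope.
Local Open Scope ring_scope.

(** * Subspaces and dimensions *)

(** The bound 2 has its origin in the bracket read modulo [I]. If [[x, y]] is [om x y] times [z]
    there and [om x y != 0], the cocycle identity expresses f(z, -) through the two functionals
    [om x] and [om y]. Both survive when [om] is an even form of rank 2; a larger rank, or a nonzero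
    bracket of odd elements with [z] even, forces f(z, -) = 0, and an odd [z] leaves one functional.
    With n the odd dimension, summation gives dim Z <= C(N-k, 2) + n + 2 + (k-1)(N-k), whereas s(L)
    = 1 means dim Z = C(N-1, 2) + n + k. The second number exceeds the first by C(k-1, 2) + k - 2,
    which is positive for k >= 3 and 0 for k = 2; this makes k = 2 the rigid case. For k = 1 the
    possible values of dim Z jump over the required one. The free superalgebra is infinite
    dimensional and the multiplier is a subquotient of it, so all counting takes place in the
    finite-dimensional space of bilinear forms on a model of L by row vectors. *)

Section Subspaces.
Variables (K : fieldType) (W : lmodType K).
Implicit Types (A B : set W).

Lemma subspace0 A : subspace A -> A 0. Proof. by case. Qed.

Lemma subspaceD A x y : subspace A -> A x -> A y -> A (x + y).
Proof. by move=> [_ h] hx hy; rewrite -[x]scale1r; apply: h. Qed.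

Lemma subspaceZ A a x : subspace A -> A x -> A (a *: x).
Proof. by move=> [h0 h] hx; rewrite -[_ *: _]addr0; apply: h. Qed.

Lemma subspaceN A x : subspace A -> A x -> A (- x).
Proof. by move=> hA hx; rewrite -scaleN1r; apply: subspaceZ. Qed.

Lemma subspaceB A x y : subspace A -> A x -> A y -> A (x - y).
Proof. by move=> hA hx hy; apply: subspaceD => //; apply: subspaceN. Qed.

Lemma subspace_sum A (I : Type) (r : seq I) (F : I -> W) :
  subspace A -> (forall i, A (F i)) -> A (\sum_(i <- r) F i).
Proof.
move=> hA hF; apply: (big_ind A) => //; first exact: subspace0.
by move=> x y; apply: subspaceD.
Qed.

Lemma subspaceI A B : subspace A -> subspace B -> subspace (A `&` B).
Proof.
move=> [A0 hA] [B0 hB]; split=> // a x y [? ?] [? ?].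
by split; [apply: hA | apply: hB].
Qed.

Lemma subspace_lincomb A (n : nat) (c : 'rV[K]_n) (e : 'I_n -> W) :
  subspace A -> (forall i, A (e i)) -> A (\sum_i c ord0 i *: e i).
Proof. by move=> hA he; apply: subspace_sum => // i; apply: subspaceZ. Qed.

Lemma linear_span_subspace (S : set W) : subspace (linear_span S).
Proof.
split=> [B [[B0 _] _] //|a x y hx hy B hB].
by apply: (hB.1).2; [apply: hx | apply: hy].
Qed.

Lemma mem_linear_span (S : set W) x : S x -> linear_span S x.
Proof. by move=> Sx B [_]; apply. Qed.

Lemma linear_span_min (S : set W) B :
  subspace B -> S `<=` B -> linear_span S `<=` B.
Proof. exact: smallest_sub. Qed.

End Subspaces.

Section Linear.
Variables (K : fieldType) (V W : lmodType K) (f : V -> W).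
Hypothesis hf : linear f.

Lemma lin0 : f 0 = 0.
Proof. by have := hf (-1) 0 0; rewrite scaler0 add0r scaleN1r addNr. Qed.
Lemma linZ a x : f (a *: x) = a *: f x.
Proof. by rewrite -[_ *: x]addr0 hf lin0 addr0. Qed.
Lemma linD x y : f (x + y) = f x + f y.
Proof. by rewrite -[x in LHS]scale1r hf scale1r. Qed.
Lemma linN x : f (- x) = - f x.
Proof. by rewrite -scaleN1r linZ scaleN1r. Qed.
Lemma linB x y : f (x - y) = f x - f y.
Proof. by rewrite linD linN. Qed.

Lemma subspace_preim (B : set W) : subspace B -> subspace (f @^-1` B).
Proof.
move=> [B0 hB]; split=> [|a x y hx hy] /=; first by rewrite lin0.
by rewrite hf; apply: hB.
Qed.

Lemma subspace_image (A : set V) : subspace A -> subspace (f @` A).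
Proof.
move=> [A0 hA]; split=> [|a _ _ [x hx <-] [y hy <-]].
  by exists 0; rewrite ?lin0.
by exists (a *: x + y); [apply: hA | rewrite hf].
Qed.

End Linear.

Lemma linear_comb (K : fieldType) (W W' : lmodType K) (f : W -> W') n
    (c : 'rV[K]_n) (e : 'I_n -> W) : linear f ->
  f (\sum_i c ord0 i *: e i) = \sum_i c ord0 i *: f (e i).
Proof.
move=> hf; apply: (big_ind2 (fun u v => f u = v)) => [|x1 x2 y1 y2 <- <-|i _].
- exact: lin0 hf.
- exact: linD hf _ _.
- exact: linZ hf _ _.
Qed.

Lemma lfun_exists (K : fieldType) (V W : vectType K) (f : V -> W) :
  linear f -> exists g : 'Hom(V, W), forall x, g x = f x.
Proof.
move=> hf; pose m := GRing.isLinear.Build _ _ _ _ f hf.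
pose F : {linear V -> W} := HB.pack f m.
by exists (linfun F) => x; rewrite lfunE.
Qed.

Section VspaceOf.
Variables (K : fieldType) (V : vectType K).

(** A vspace of maximal dimension inside [A] exhausts it, since adding the line of a missed point
    would raise the dimension. *)
Lemma subspace_vspace (A : set V) : subspace A ->
  exists U : {vspace V}, forall x, A x <-> x \in U.
Proof.
move=> hA.
pose P d := `[< exists U : {vspace V}, \dim U = d /\ (forall x, x \in U -> A x) >].
have exP : exists d, P d.
  exists 0%N; apply/asboolP; exists 0%VS; split; first exact: dimv0.
  by move=> x; rewrite memv0 => /eqP ->; apply: subspace0.
have bP d : P d -> (d <= \dim {:V})%N.
  by move=> /asboolP [U [<- _]]; apply: dimvS; apply: subvf.
case: (ex_maxnP exP bP) => d /asboolP [U [dU UA]] dmax.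
exists U => x; split=> [Ax|]; last exact: UA.
have /dmax : P (\dim (U + <[x]>)%VS).
  apply/asboolP; exists (U + <[x]>)%VS; split=> // y /memv_addP [u uU [v]].
  by move=> /vlineP [c ->] ->; apply: subspaceD => //; [exact: UA | exact: subspaceZ].
rewrite -dU => hle.
have /eqP -> : U == (U + <[x]>)%VS by rewrite eqEdim addvSl hle.
by apply: subvP (addvSr _ _) _ (memv_line x).
Qed.

Definition vspace_of (A : set V) : {vspace V} :=
  xget 0%VS [set U : {vspace V} | forall x, A x <-> x \in U].

Lemma mem_vspace_of (A : set V) x : subspace A -> A x <-> x \in vspace_of A.
Proof.
move=> /subspace_vspace hU.
by have := xgetPex 0%VS (hU : exists U, [set U : {vspace V} | forall y, A y <-> y \in U] U).
Qed.

Lemma vspace_subspace (U : {vspace V}) : subspace [set x | x \in U].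
Proof. by split=> [|a x y hx hy]; rewrite /= ?mem0v ?memvD ?memvZ. Qed.

End VspaceOf.

Section QuotDim.
Variable K : fieldType.

Lemma quot_dim_vspace (V : vectType K) (U : {vspace V}) d :
  quot_dim [set x | x \in U] [set 0] d -> \dim U = d.
Proof.
move=> [e [eU he]].
have hlin : linear (fun c : 'rV[K]_d => \sum_i c ord0 i *: e i).
  move=> a x y; rewrite scaler_sumr -big_split /=; apply: eq_bigr => i _.
  by rewrite !mxE scalerDl scalerA.
have [g hg] := lfun_exists hlin.
have ginj : (lker g == 0)%VS.
  rewrite -subv0; apply/subvP => c; rewrite memv_ker hg memv0 => /eqP hc.
  have [c' [_ hu]] := he 0 (mem0v U).
  rewrite -(hu c) ?(hu 0) //=; first by rewrite sub0r; rewrite big1 ?oppr0 // => i _; rewrite mxE scale0r.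
  by rewrite hc subr0.
have <- : (g @: fullv = U)%VS.
  apply/vspaceP => x; apply/memv_imgP/idP => [[c _ ->]|xU].
    by rewrite hg; apply: memv_suml => i _; apply: memvZ; apply: eU.
  have [c [/= hc _]] := he x xU; exists c; rewrite ?memvf // hg.
  by apply/eqP; rewrite -subr_eq0 hc.
by rewrite limg_dim_eq ?(eqP ginj) ?capv0 // dimvf /dim /= mul1n.
Qed.

Variable W : lmodType K.
Implicit Types A B : set W.

(** As [W] may be infinite dimensional, the complement is taken among coefficient vectors: [T]
    complements the preimage of [B] in the preimage of [A] under [G]. *)
Lemma quot_dim_exists A B r (g : 'I_r -> W) :
  subspace A -> subspace B -> B `<=` A ->
  (forall x, A x -> exists c : 'rV[K]_r, B (x - \sum_i c ord0 i *: g i)) ->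
  exists d, quot_dim A B d.
Proof.
move=> hA hB BA hg.
pose G (c : 'rV[K]_r) := \sum_i c ord0 i *: g i.
have Glin : linear G.
  move=> a x y; rewrite /G scaler_sumr -big_split /=; apply: eq_bigr => i _.
  by rewrite !mxE scalerDl scalerA.
have sC := subspace_preim Glin hA; have sC0 := subspace_preim Glin hB.
pose U := vspace_of (G @^-1` A); pose U0 := vspace_of (G @^-1` B).
have UP c : A (G c) <-> c \in U := mem_vspace_of c sC.
have U0P c : B (G c) <-> c \in U0 := mem_vspace_of c sC0.
pose T := (U :\: U0)%VS; exists (\dim T).
exists (fun i => G (vbasis T)`_i); split=> [i|x Ax].
  apply/UP; apply: subvP (diffvSl U U0) _ _.
  by apply: vbasis_mem; rewrite mem_nth ?size_tuple.
have GT (c : 'rV[K]_(\dim T)) : \sum_i c ord0 i *: G (vbasis T)`_i =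
    G (\sum_i c ord0 i *: (vbasis T)`_i).
  by rewrite linear_comb.
have [c Bc] := hg x Ax.
have cU : c \in U.
  by apply/UP; rewrite -[G c](subKr x); apply: subspaceB => //; apply: BA.
move: cU; rewrite -(addv_diff_cap U U0) -/T.
move=> /memv_addP [t tT [u /memv_capP [_ uU0] cE]].
exists (\row_i coord (vbasis T) i t); split=> [|c'].
  rewrite GT; have -> : \sum_i (\row_i0 coord (vbasis T) i0 t) ord0 i *: (vbasis T)`_i = t.
    by rewrite [RHS](coord_vbasis tT); apply: eq_bigr => i _; rewrite mxE.
  have -> : G t = G c - G u by rewrite -(linB Glin) cE addrK.
  by rewrite opprB addrCA; apply: subspaceD => //; apply/U0P.
rewrite GT => hc'; set t' := \sum_i _ in hc'.
have t'T : t' \in T.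
  by apply: memv_suml => i _; apply/memvZ/vbasis_mem; rewrite mem_nth ?size_tuple.
have : t - t' \in (T :&: U0)%VS.
  rewrite memv_cap memvB //=; apply/U0P; rewrite (linB Glin).
  have -> : G t - G t' = (x - G t') - (x - G c) - G u.
    by rewrite cE (linD Glin) opprB [_ + (_ - x)]addrC subrKA addrAC addrK.
  by apply: subspaceB => //; [exact: subspaceB | exact/U0P].
rewrite capv_diff memv0 subr_eq0 => /eqP ->; apply/rowP => i; rewrite mxE.
by rewrite /t' coord_sum_free // (basis_free (vbasisP T)).
Qed.

End QuotDim.

(** * Projections onto the even and odd components *)

Section HomogeneousParts.
Variables (K : numFieldType) (L : lieSuper K).

Lemma hpart_subproof : exists q : bool -> L -> L,
  forall x, (forall b, component L b (q b x)) /\ x = q false x + q true x.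
Proof.
have /choice [q hq] : forall x : L, exists u : L * L,
    [/\ component L false u.1, component L true u.2 & x = u.1 + u.2].
  by move=> x; have [x0 [x1 [? [? ?]]]] := component_span x; exists (x0, x1).
exists (fun b x => if b then (q x).2 else (q x).1) => x.
by have [? ? ?] := hq x; split=> // -[].
Qed.

Definition hpart : bool -> L -> L := sval (cid hpart_subproof).

Lemma hpart_mem b x : component L b (hpart b x).
Proof. by rewrite /hpart; case: cid => q /= /(_ x) []. Qed.

Lemma hpartE x : x = hpart false x + hpart true x.
Proof. by rewrite /hpart; case: cid => q /= /(_ x) []. Qed.

Lemma hpart_uniq b (x y z : L) : component L b y -> component L (~~ b) z ->
  x = y + z -> hpart b x = y.
Proof.
move=> hy hz xE; have := hpartE x.
have -> : hpart false x + hpart true x = hpart b x + hpart (~~ b) x.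
  by case: b {hy hz} => //=; rewrite addrC.
rewrite {1}xE => hE; have h : hpart b x - y = z - hpart (~~ b) x.
  by apply/eqP; rewrite subr_eq addrAC eq_sym subr_eq -hE addrC.
apply/eqP; rewrite -subr_eq0; apply/eqP.
have h1 : component L b (hpart b x - y).
  by apply: subspaceB => //; [exact: component_subspace|exact: hpart_mem].
have h2 : component L (~~ b) (hpart b x - y).
  rewrite h.
  by apply: subspaceB => //; [exact: component_subspace|exact: hpart_mem].
by case: b {hy hz h hE} h1 h2 => /= h1 h2; apply: component_direct.
Qed.

Lemma hpart_id b x : component L b x -> hpart b x = x.
Proof.
move=> hx; apply: (hpart_uniq hx (z := 0)); last by rewrite addr0.
exact: subspace0 (component_subspace _ _).
Qed.

Lemma hpart_other b x : component L b x -> hpart (~~ b) x = 0.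
Proof.
move=> hx; apply: (@hpart_uniq _ x 0 x); rewrite ?add0r ?negbK //.
exact: subspace0 (component_subspace _ _).
Qed.

Lemma hpart_linear b : linear (hpart b).
Proof.
move=> a x y; apply: (@hpart_uniq _ _ _ (a *: hpart (~~ b) x + hpart (~~ b) y)).
- by apply: (component_subspace L b).2; apply: hpart_mem.
- by apply: (component_subspace L (~~ b)).2; apply: hpart_mem.
rewrite addrACA -scalerDr; congr (a *: _ + _).
  by rewrite [LHS]hpartE; case: b => //; rewrite addrC.
by rewrite [LHS]hpartE; case: b => //; rewrite addrC.
Qed.

Lemma bracket_hparts (x y : L) : bracket L x y =
  (bracket L (hpart false x) (hpart false y) +
   bracket L (hpart false x) (hpart true y)) +
  (bracket L (hpart true x) (hpart false y) +
   bracket L (hpart true x) (hpart true y)).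
Proof.
rewrite {1}(hpartE x) {1}(hpartE y) (linD (bracket_linearl _)).
by rewrite !(linD (bracket_linearr _)).
Qed.

End HomogeneousParts.

Lemma hpart_graded (K : numFieldType) (L M : lieSuper K) (f : L -> M) b x :
  linear f -> (forall a x, component L a x -> component M a (f x)) ->
  f (hpart b x) = hpart b (f x).
Proof.
move=> hl hc; symmetry; apply: (@hpart_uniq _ _ _ _ _ (f (hpart (~~ b) x))).
- by apply: hc; apply: hpart_mem.
- by apply: hc; apply: hpart_mem.
by rewrite -(linD hl); congr f; rewrite [LHS]hpartE; case: b => //=; rewrite addrC.
Qed.

Lemma hpart_hom (K : numFieldType) (L M : lieSuper K) (f : L -> M) b x :
  is_hom f -> f (hpart b x) = hpart b (f x).
Proof. by move=> [hl [hc _]]; apply: hpart_graded. Qed.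

(** * Free Lie superalgebras *)

(* The free Lie superalgebra is the term algebra modulo the identities that
   hold in every Lie superalgebra; [FPart b] denotes the component of parity b,
   so that a class t is homogeneous iff t = FPart b t is such an identity. *)
Section FreeLieSuper.
Variables (K : numFieldType) (X : Type) (p : X -> bool).

Inductive fterm : Type :=
| FGen of X
| FZero
| FAdd of fterm & fterm
| FScale of K & fterm
| FBr of fterm & fterm
| FPart of bool & fterm.

Fixpoint feval (G : lieSuper K) (g : X -> G) (t : fterm) : G :=
  match t with
  | FGen x => g x
  | FZero => 0
  | FAdd s t => feval g s + feval g t
  | FScale a t => a *: feval g t
  | FBr s t => bracket G (feval g s) (feval g t)
  | FPart b t => hpart b (feval g t)
  end.

Definition feq (s t : fterm) : Prop :=
  forall (G : lieSuper K) (g : X -> G), (forall x, component G (p x) (g x)) ->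
  feval g s = feval g t.

Definition feqb (s t : {classic fterm}) : bool := `[< feq s t >].

Lemma feqb_refl : reflexive feqb.
Proof. by move=> s; apply/asboolP. Qed.
Lemma feqb_sym : symmetric feqb.
Proof. by move=> s t; apply/asboolP/asboolP => h G g hg; rewrite h. Qed.
Lemma feqb_trans : transitive feqb.
Proof.
by move=> t s u /asboolP h1 /asboolP h2; apply/asboolP => G g hg; rewrite h1 ?h2.
Qed.

Canonical feqb_equiv := EquivRel feqb feqb_refl feqb_sym feqb_trans.

Definition ffree : Type := {eq_quot feqb_equiv}%qT.
HB.instance Definition _ := Choice.on ffree.

Definition fclass (t : fterm) : ffree := (\pi_{eq_quot feqb_equiv} (t : {classic fterm}))%qT.
Definition frepr (u : ffree) : fterm := repr u.

Lemma freprK u : fclass (frepr u) = u.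
Proof. exact: reprK. Qed.

Lemma fclassP s t : fclass s = fclass t <-> feq s t.
Proof.
split=> [/eqmodP /asboolP //|h]; apply/eqmodP; exact/asboolP.
Qed.

Lemma frepr_class t : feq (frepr (fclass t)) t.
Proof. by apply/fclassP; rewrite freprK. Qed.

Definition fadd (u v : ffree) := fclass (FAdd (frepr u) (frepr v)).
Definition fopp (u : ffree) := fclass (FScale (-1) (frepr u)).
Definition fscale a (u : ffree) := fclass (FScale a (frepr u)).
Definition fbr (u v : ffree) := fclass (FBr (frepr u) (frepr v)).
Definition fcomp b : set ffree := [set u | feq (FPart b (frepr u)) (frepr u)].

Lemma faddA : associative fadd.
Proof. by move=> u v w; apply/fclassP => G g hg /=; rewrite !frepr_class //= addrA. Qed.
Lemma faddC : commutative fadd.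
Proof. by move=> u v; apply/fclassP => G g hg /=; rewrite addrC. Qed.
Lemma fadd0 : left_id (fclass FZero) fadd.
Proof.
by move=> u; rewrite -[RHS]freprK; apply/fclassP => G g hg /=; rewrite !frepr_class //= add0r.
Qed.
Lemma faddN : left_inverse (fclass FZero) fopp fadd.
Proof.
by move=> u; apply/fclassP => G g hg /=; rewrite !frepr_class //= scaleN1r addNr.
Qed.

HB.instance Definition _ := GRing.isZmodule.Build ffree faddA faddC fadd0 faddN.

Lemma fscaleA a b (v : ffree) : fscale a (fscale b v) = fscale (a * b) v.
Proof. by apply/fclassP => G g hg /=; rewrite !frepr_class //= scalerA. Qed.
Lemma fscale1 : left_id 1 fscale.
Proof.
by move=> u; rewrite -[RHS]freprK; apply/fclassP => G g hg /=; rewrite scale1r.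
Qed.
Lemma fscaleDr : right_distributive fscale +%R.
Proof. by move=> a u v; apply/fclassP => G g hg /=; rewrite !frepr_class //= scalerDr. Qed.
Lemma fscaleDl (v : ffree) : {morph fscale^~ v : a b / a + b}.
Proof. by move=> a b; apply/fclassP => G g hg /=; rewrite !frepr_class //= scalerDl. Qed.

HB.instance Definition _ :=
  GRing.Zmodule_isLmodule.Build K ffree fscaleA fscale1 fscaleDr fscaleDl.

Section Eval.
Variables (G : lieSuper K) (g : X -> G).
Hypothesis hg : forall x, component G (p x) (g x).

Definition fext (u : ffree) : G := feval g (frepr u).

Lemma fext_class t : fext (fclass t) = feval g t.
Proof. exact: frepr_class. Qed.

Lemma fext_linear : linear fext.
Proof.
by move=> a u v; rewrite /fext frepr_class //= frepr_class.
Qed.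

Lemma fext_br u v : fext (fbr u v) = bracket G (fext u) (fext v).
Proof. exact: frepr_class. Qed.

Lemma fext_comp b u : fcomp b u -> component G b (fext u).
Proof. by rewrite /fext => /(_ G g hg) /= <-; apply: hpart_mem. Qed.

End Eval.

Lemma ffree_ext (u v : ffree) : (forall (G : lieSuper K) (g : X -> G),
  (forall x, component G (p x) (g x)) -> fext g u = fext g v) -> u = v.
Proof.
by move=> h; rewrite -[u]freprK -[v]freprK; apply/fclassP => G g hg; apply: h.
Qed.

Lemma fcompP b (u : ffree) : fcomp b u <-> forall (G : lieSuper K) (g : X -> G),
  (forall x, component G (p x) (g x)) -> component G b (fext g u).
Proof.
split=> [h G g hg|h]; first exact: fext_comp.
by move=> G g hg /=; apply: hpart_id; apply: h.
Qed.

Lemma ffree_subspace b : subspace (fcomp b).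
Proof.
split=> [|a x y /fcompP hx /fcompP hy]; apply/fcompP => G g hg.
  by rewrite (lin0 (fext_linear hg)); apply: subspace0 (component_subspace _ _).
by rewrite fext_linear //; apply: (component_subspace G b).2; [exact: hx|exact: hy].
Qed.

(** The constructor [FPart] serves this purpose: it supplies the homogeneous parts of a class
    without an induction over terms. *)
Lemma ffree_span (x : ffree) :
  exists x0 x1, fcomp false x0 /\ fcomp true x1 /\ x = x0 + x1.
Proof.
exists (fclass (FPart false (frepr x))), (fclass (FPart true (frepr x))).
split; [|split]; first 1 [apply/fcompP => G g hg; rewrite fext_class //; exact: hpart_mem].
  by apply/fcompP => G g hg; rewrite fext_class //; exact: hpart_mem.
by apply: ffree_ext => G g hg; rewrite (linD (fext_linear hg)) !fext_class //= -hpartE.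
Qed.

Lemma ffree_direct (x : ffree) : fcomp false x -> fcomp true x -> x = 0.
Proof.
move=> /fcompP h0 /fcompP h1; apply: ffree_ext => G g hg.
rewrite (lin0 (fext_linear hg)); apply: component_direct; [exact: h0|exact: h1].
Qed.

Lemma ffree_linearl (y : ffree) : linear (fbr^~ y).
Proof.
move=> a u v; apply: ffree_ext => G g hg.
by rewrite fext_linear // !fext_br // fext_linear // bracket_linearl.
Qed.

Lemma ffree_linearr (x : ffree) : linear (fbr x).
Proof.
move=> a u v; apply: ffree_ext => G g hg.
by rewrite fext_linear // !fext_br // fext_linear // bracket_linearr.
Qed.

Lemma ffree_comp a b (x y : ffree) :
  fcomp a x -> fcomp b y -> fcomp (a (+) b) (fbr x y).
Proof.
move=> /fcompP h0 /fcompP h1; apply/fcompP => G g hg.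
by rewrite fext_br //; apply: bracket_component; [exact: h0|exact: h1].
Qed.

Lemma ffree_skew a b (x y : ffree) : fcomp a x -> fcomp b y ->
  fbr x y = - ((-1) ^+ (a && b) *: fbr y x).
Proof.
move=> /fcompP h0 /fcompP h1; apply: ffree_ext => G g hg.
rewrite (linN (fext_linear hg)) (linZ (fext_linear hg)) !fext_br //.
by apply: bracket_skew; [exact: h0|exact: h1].
Qed.

Lemma ffree_jacobi a b (x y z : ffree) : fcomp a x -> fcomp b y ->
  fbr x (fbr y z) = fbr (fbr x y) z + (-1) ^+ (a && b) *: fbr y (fbr x z).
Proof.
move=> /fcompP h0 /fcompP h1; apply: ffree_ext => G g hg.
rewrite (linD (fext_linear hg)) (linZ (fext_linear hg)) !fext_br //.
by apply: bracket_jacobi; [exact: h0|exact: h1].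
Qed.

Definition free_super : lieSuper K :=
  LieSuper ffree_subspace ffree_span ffree_direct ffree_linearl ffree_linearr
    ffree_comp ffree_skew ffree_jacobi.

Lemma fclass_gen_comp x : component free_super (p x) (fclass (FGen x)).
Proof. by apply/fcompP => G g hg; rewrite fext_class //; apply: hg. Qed.

(** Uniqueness is an induction on terms. The case of [FPart] rests on the fact that homomorphisms,
    being even, commute with [hpart]. *)
Lemma free_superP : @is_free K free_super X p (fun x => fclass (FGen x)).
Proof.
split=> [x|G g hg]; first exact: fclass_gen_comp.
exists (fext g); split=> [|f [hf fg]].
  split=> [|x]; last exact: fext_class.
  by split; [exact: fext_linear|split=> [a x|x y]; [exact: fext_comp|exact: fext_br]].
have /= [fl [fc fb]] := hf.
suff h t : f (fclass t) = feval g t.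
  by apply/funext => u; rewrite -[in RHS](freprK u) h.
have fhp b (u : free_super) : hpart b u = fclass (FPart b (frepr u)).
  apply: (@hpart_uniq _ _ _ _ _ (fclass (FPart (~~ b) (frepr u)) : free_super)).
  - by apply/fcompP => H h hh; rewrite fext_class //; apply: hpart_mem.
  - by apply/fcompP => H h hh; rewrite fext_class //; apply: hpart_mem.
  apply: ffree_ext => H h hh; rewrite (linD (fext_linear hh)) !fext_class //=.
  by rewrite [LHS]hpartE; case: b => //; rewrite addrC.
elim: t => [x||s IHs t IHt|a t IHt|s IHs t IHt|b t IHt] /=.
- exact: fg.
- exact: (lin0 fl).
- rewrite -IHs -IHt -(linD fl); congr f.
  by apply: ffree_ext => H h hh; rewrite (linD (fext_linear hh)) !fext_class.
- rewrite -IHt -(linZ fl); congr f.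
  by apply: ffree_ext => H h hh; rewrite (linZ (fext_linear hh)) !fext_class.
- rewrite -IHs -IHt -fb; congr f.
  by apply: ffree_ext => H h hh; rewrite fext_br // !fext_class.
- rewrite -IHt -(hpart_hom _ _ hf) fhp; congr f.
  by apply/fclassP => H h hh /=; rewrite frepr_class.
Qed.

End FreeLieSuper.

Lemma free_presentation_exists (K : numFieldType) (L : lieSuper K) :
  exists (F : lieSuper K) (pi : F -> L), free_presentation pi.
Proof.
(* All homogeneous elements serve as generators; they carry their parity as a tag because 0 has both
   parities. *)
pose X := {u : bool * L | component L u.1 u.2}.
pose p (u : X) := (sval u).1; pose g (u : X) := (sval u).2.
have hg u : component L (p u) (g u) by case: u.
have [gc hF] := free_superP K p; have [pi [[hpi pig] _]] := hF L g hg.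
exists (free_super K p), pi; split; first by exists X, p, (fun x => fclass p (FGen K x)).
split=> // y.
pose gen b : X := exist _ (b, hpart b y) (hpart_mem b y).
exists (fclass p (FGen K (gen false)) + fclass p (FGen K (gen true)) : free_super K p).
by rewrite (linD hpi.1) !pig /= -hpartE.
Qed.

(** * Bilinear forms, annihilators and separating functionals *)

Section Functionals.
Variables (K : fieldType) (V : vectType K).

Lemma bilinear_exists (f : V -> V -> K) :
  (forall y, scalar (f^~ y)) -> (forall x, scalar (f x)) ->
  exists b : 'Hom(V, 'Hom(V, K^o)), forall x y, b x y = f x y.
Proof.
move=> hl hr.
have /choice [g hg] : forall x, exists g : 'Hom(V, K^o), forall y, g y = f x y.
  by move=> x; apply: (@lfun_exists _ _ K^o (f x)) => a u v; apply: hr.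
have [b hb] : exists b : 'Hom(V, 'Hom(V, K^o)), forall x, b x = g x.
  apply: lfun_exists => a u v; apply/lfunP => y.
  by rewrite add_lfunE scale_lfunE !hg; apply: hl.
by exists b => x y; rewrite hb hg.
Qed.

Lemma annihilator_subspace (U : {vspace V}) :
  subspace [set f : 'Hom(V, K^o) | forall u, u \in U -> f u = 0].
Proof.
split=> [u _|a f g hf hg u uU] /=; first by rewrite zero_lfunE.
by rewrite add_lfunE scale_lfunE hf // hg // scaler0 addr0.
Qed.

Definition annihilator (U : {vspace V}) : {vspace 'Hom(V, K^o)} :=
  vspace_of [set f : 'Hom(V, K^o) | forall u, u \in U -> f u = 0].

Lemma annihilatorP (U : {vspace V}) (f : 'Hom(V, K^o)) :
  f \in annihilator U <-> forall u, u \in U -> f u = 0.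
Proof. by rewrite -(mem_vspace_of _ (annihilator_subspace U)). Qed.

(** Evaluation on a basis of a complement of [U] maps the annihilator isomorphically onto row
    vectors. *)
Lemma dim_annihilator (U : {vspace V}) :
  (\dim (annihilator U) + \dim U = \dim {:V})%N.
Proof.
pose b := vbasis (U^C)%VS; pose d := \dim (U^C)%VS.
have [T hT] : exists T : 'Hom('Hom(V, K^o), 'rV[K]_d),
    forall f, T f = \row_i (f b`_i : K).
  apply: lfun_exists => a f g; apply/rowP => i.
  by rewrite !mxE add_lfunE scale_lfunE.
have Tker : (annihilator U :&: lker T = 0)%VS.
  apply/eqP; rewrite -subv0; apply/subvP => f /memv_capP [/annihilatorP fU].
  rewrite memv_ker hT memv0 => /eqP f0; apply/eqP/lfunP => x; rewrite zero_lfunE.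
  have : x \in (U + U^C)%VS by rewrite addv_complf memvf.
  move=> /memv_addP [u uU [v vU ->]]; rewrite linearD /= fU // add0r.
  rewrite (coord_vbasis vU) linear_sum big1 // => i _; rewrite linearZ /=.
  by have /rowP /(_ i) := f0; rewrite !mxE => ->; rewrite scaler0.
have Timg : (T @: annihilator U = fullv)%VS.
  apply/eqP; rewrite eqEsubv subvf /=; apply/subvP => c _; apply/memv_imgP.
  have [f hf] : exists f : 'Hom(V, K^o), forall x,
      f x = \sum_i c ord0 i * coord b i (daddv_pi U^C U x).
    apply: (@lfun_exists _ _ K^o) => a x y; rewrite scaler_sumr -big_split /=.
    apply: eq_bigr => i _; by rewrite !linearP /= mulrDr mulrCA.
  exists f.
    apply/annihilatorP => u uU; rewrite hf big1 // => i _.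
    suff -> : daddv_pi U^C U u = 0 by rewrite linear0 mulr0.
    have hc : (U^C :&: U = 0)%VS by rewrite capvC capv_compl.
    have hu : u \in (U^C + U)%VS by rewrite addvC addv_complf memvf.
    have := daddv_pi_add hc hu; rewrite (daddv_pi_id _ uU) ?capv_compl //.
    by rewrite -[RHS]add0r => /addIr.
  rewrite hT; apply/rowP => i; rewrite mxE hf.
  have bi : b`_i \in (U^C)%VS by apply: vbasis_mem; rewrite mem_nth ?size_tuple.
  rewrite daddv_pi_id //; last by rewrite capvC capv_compl.
  rewrite (bigD1 i) //= big1 ?addr0 => [|j ji].
    by rewrite coord_free ?eqxx ?mulr1 // (basis_free (vbasisP _)).
  by rewrite coord_free ?(basis_free (vbasisP _)) // eq_sym (negbTE ji) mulr0.
have dU : (d + \dim U)%N = \dim {:V}.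
  by rewrite /d dimv_compl subnK // dimvS // subvf.
by rewrite -dU -(limg_dim_eq Tker) Timg dimvf /dim /= mul1n.
Qed.

(** Otherwise [U] and [U + <[z]>] would have the same annihilator, against [dim_annihilator]. *)
Lemma separating_functional (U : {vspace V}) z : z \notin U ->
  exists f : 'Hom(V, K^o), (forall u, u \in U -> f u = 0) /\ f z = 1.
Proof.
move=> zU; have [h|] := pselect (exists2 f, f \in annihilator U & f z != 0).
  have [f /annihilatorP fU fz] := h; exists ((f z : K)^-1 *: f).
  split=> [u uU|]; rewrite scale_lfunE; first by rewrite (fU u uU) scaler0.
  exact: mulVf.
move=> h; have sub : (annihilator U <= annihilator (U + <[z]>))%VS.
  apply/subvP => f fU; apply/annihilatorP => _ /memv_addP [u uU [_ /vlineP [c ->] ->]].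
  rewrite linearD linearZ /=; move: (fU) => /annihilatorP -> //.
  have [->|fz] := eqVneq (f z) 0; first by rewrite scaler0 addr0.
  by case: h; exists f.
have := dimvS sub; have := dim_annihilator U; have := dim_annihilator (U + <[z]>).
rewrite dimv_disjoint_sum; last first.
  apply/eqP; rewrite -subv0; apply/subvP => w /memv_capP [wU /vlineP [c wE]].
  move: wU; rewrite wE memv0; have [->|c0] := eqVneq c 0; first by rewrite scale0r eqxx.
  by move=> /(memvZ c^-1); rewrite scalerA mulVf // scale1r (negbTE zU).
have -> : \dim <[z]> = 1%N.
  by rewrite dim_vline; case: eqP zU => // ->; rewrite mem0v.
lia.
Qed.

End Functionals.

(** * Skew forms and 2-cocycles *)

(* lia only recognizes the dimensions once they are generalized at type nat. *)
Ltac dimlia :=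
  repeat match goal with |- context [@dimv ?K ?V ?U] =>
    let d := fresh "d" in set d : nat := @dimv K V U; clearbody d end;
  lia.

(* A finite-dimensional [lieSuper], with the components as vspaces. *)
Record vectSuper (K : numFieldType) (V : vectType K) := VectSuper {
  vpar : bool -> {vspace V};
  vbr : V -> V -> V;
  vpar_span : (vpar false + vpar true = fullv)%VS;
  vpar_cap : (vpar false :&: vpar true = 0)%VS;
  vbr_linearl : forall y, linear (vbr^~ y);
  vbr_linearr : forall x, linear (vbr x);
  vbr_par : forall a b x y, x \in vpar a -> y \in vpar b ->
    vbr x y \in vpar (a (+) b);
  vbr_skew : forall a b x y, x \in vpar a -> y \in vpar b ->
    vbr x y = - ((-1) ^+ (a && b) *: vbr y x);
  vbr_jacobi : forall a b x y z, x \in vpar a -> y \in vpar b ->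
    vbr x (vbr y z) = vbr (vbr x y) z + (-1) ^+ (a && b) *: vbr y (vbr x z)
}.

Section SuperOf.
Variables (K : numFieldType) (V : vectType K) (A : vectSuper V).

Lemma vpar_exists (x : V) : exists x0 x1,
  x0 \in vpar A false /\ x1 \in vpar A true /\ x = x0 + x1.
Proof.
have : x \in (vpar A false + vpar A true)%VS by rewrite vpar_span memvf.
by move=> /memv_addP [u hu [v hv ->]]; exists u, v.
Qed.

Lemma vpar_direct (x : V) : x \in vpar A false -> x \in vpar A true -> x = 0.
Proof.
by move=> h0 h1; apply/eqP; rewrite -memv0 -(vpar_cap A) memv_cap h0 h1.
Qed.

Definition super_of : lieSuper K :=
  @LieSuper K V (fun a => [set x | x \in vpar A a]) (vbr A)
    (fun a => vspace_subspace (vpar A a)) vpar_exists vpar_direct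
    (@vbr_linearl K V A) (@vbr_linearr K V A) (@vbr_par K V A) (@vbr_skew K V A)
    (@vbr_jacobi K V A).

End SuperOf.

Section Cocycles.
Variables (K : numFieldType) (V : vectType K) (A : vectSuper V).
Local Notation P := (vpar A).
Local Notation "[ x , y ]" := (vbr A x y) (at level 0).
Local Notation form := 'Hom(V, 'Hom(V, K^o)).

Definition vpart (b : bool) : 'End(V) := daddv_pi (P b) (P (~~ b)).

Lemma vpar_capb b : (P b :&: P (~~ b) = 0)%VS.
Proof. by case: b => /=; rewrite ?vpar_cap // capvC vpar_cap. Qed.

Lemma vpart_mem b x : vpart b x \in P b. Proof. exact: memv_pi. Qed.

Lemma vpart_id b x : x \in P b -> vpart b x = x.
Proof. exact/daddv_pi_id/vpar_capb. Qed.

Lemma vpartE x : x = vpart false x + vpart true x.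
Proof. by rewrite daddv_pi_add ?vpar_cap // vpar_span memvf. Qed.

Lemma vpart_other b x : x \in P b -> vpart (~~ b) x = 0.
Proof.
move=> hx; have := vpartE x; case: b hx => hx /=.
  by rewrite [vpart true x](vpart_id hx) -{1}[x]add0r => /addIr.
by rewrite [vpart false x](vpart_id hx) -{1}[x]addr0 => /addrI.
Qed.

Lemma homogeneous_ind (Q : V -> Prop) :
  (forall x y, Q x -> Q y -> Q (x + y)) ->
  (forall b x, x \in P b -> Q x) -> forall x, Q x.
Proof. by move=> hD hP x; rewrite [x]vpartE; apply: hD; apply: hP (vpart_mem _ _). Qed.

Lemma vbrDl x y z : [x + y, z] = [x, z] + [y, z].
Proof. exact: (linD (vbr_linearl A z)). Qed.
Lemma vbrDr x y z : [z, x + y] = [z, x] + [z, y].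
Proof. exact: (linD (vbr_linearr A z)). Qed.
Lemma vbrZl a x z : [a *: x, z] = a *: [x, z].
Proof. exact: (linZ (vbr_linearl A z)). Qed.
Lemma vbrZr a x z : [z, a *: x] = a *: [z, x].
Proof. exact: (linZ (vbr_linearr A z)). Qed.
Lemma vbrNl x z : [- x, z] = - [x, z].
Proof. exact: (linN (vbr_linearl A z)). Qed.
Lemma vbrNr x z : [z, - x] = - [z, x].
Proof. exact: (linN (vbr_linearr A z)). Qed.
Lemma vbr0l z : [0, z] = 0.
Proof. exact: (lin0 (vbr_linearl A z)). Qed.
Lemma vbr0r z : [z, 0] = 0.
Proof. exact: (lin0 (vbr_linearr A z)). Qed.

Definition fval (f : form) (x y : V) : K := f x y.

Lemma fvalDl f x y z : fval f (x + y) z = fval f x z + fval f y z.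
Proof. by rewrite /fval linearD add_lfunE. Qed.
Lemma fvalDr f x y z : fval f z (x + y) = fval f z x + fval f z y.
Proof. by rewrite /fval linearD. Qed.
Lemma fvalZl f a x z : fval f (a *: x) z = a * fval f x z.
Proof. by rewrite /fval linearZ scale_lfunE. Qed.
Lemma fvalZr f a x z : fval f z (a *: x) = a * fval f z x.
Proof. by rewrite /fval linearZ. Qed.
Lemma fval0l f z : fval f 0 z = 0.
Proof. by rewrite /fval linear0 zero_lfunE. Qed.
Lemma fval0r f z : fval f z 0 = 0.
Proof. by rewrite /fval linear0. Qed.
Lemma fval_lin a f g x y : fval (a *: f + g) x y = a * fval f x y + fval g x y.
Proof. by rewrite /fval !add_lfunE !scale_lfunE. Qed.

Definition skew_form (f : form) : Prop := forall a b x y,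
  x \in P a -> y \in P b -> fval f x y = - ((-1) ^+ (a && b) * fval f y x).

(** This is the identity [bracket_jacobi] with the outer bracket replaced by [f]. Inhomogeneous
    forms are allowed, since the total dimension of the multiplier counts both parities. *)
Definition cocycle (f : form) : Prop := forall a b x y z,
  x \in P a -> y \in P b -> fval f x [y, z] =
    fval f [x, y] z + (-1) ^+ (a && b) * fval f y [x, z].

(** One argument suffices: for graded [J] and skew [f] the other follows by [vanishes_right]. *)
Definition vanishes (J : {vspace V}) (f : form) : Prop :=
  forall x y, x \in J -> fval f x y = 0.

Definition graded (J : {vspace V}) : Prop :=
  forall b x, x \in J -> vpart b x \in J.

Lemma skew_form_subspace : subspace skew_form.
Proof.
split=> [a b x y _ _|c f g hf hg a b x y hx hy].
  by rewrite /fval !zero_lfunE mulr0 oppr0.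
rewrite !fval_lin (hf a b) // (hg a b) //; ring.
Qed.

Lemma cocycle_subspace : subspace cocycle.
Proof.
split=> [a b x y z _ _|c f g hf hg a b x y z hx hy].
  by rewrite /fval !zero_lfunE mulr0 addr0.
rewrite !fval_lin (hf a b) // (hg a b) //; ring.
Qed.

Lemma vanishes_subspace J : subspace (vanishes J).
Proof.
split=> [x y _|c f g hf hg x y hx]; first by rewrite /fval !zero_lfunE.
by rewrite fval_lin hf // hg // mulr0 addr0.
Qed.

(* For a graded ideal J, these are the skew forms and the 2-cocycles of the
   quotient by J; quotient superalgebras are never formed. *)
Definition skew_forms J : {vspace form} :=
  vspace_of (skew_form `&` vanishes J).
Definition cocycles J : {vspace form} :=
  vspace_of (skew_form `&` cocycle `&` vanishes J).

Lemma skew_formsP J f : f \in skew_forms J <-> skew_form f /\ vanishes J f.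
Proof.
rewrite -mem_vspace_of //; apply: subspaceI.
  exact: skew_form_subspace.
exact: vanishes_subspace.
Qed.

Lemma cocyclesP J f :
  f \in cocycles J <-> [/\ skew_form f, cocycle f & vanishes J f].
Proof.
rewrite -mem_vspace_of; first by split=> [[[]]|[]].
apply: subspaceI (vanishes_subspace _).
exact: subspaceI skew_form_subspace cocycle_subspace.
Qed.

Lemma vanishes_right J f x y : graded J -> skew_form f -> vanishes J f ->
  y \in J -> fval f x y = 0.
Proof.
move=> gJ sf vf yJ; move: x; apply: homogeneous_ind => [u v hu hv|a x hx].
  by rewrite fvalDl hu hv addr0.
have h b : fval f x (vpart b y) = 0.
  by rewrite (sf a b) ?vpart_mem // vf ?gJ // mulr0 oppr0.
by rewrite [y]vpartE fvalDr !h addr0.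
Qed.

Lemma skew_even f x : skew_form f -> x \in P false -> fval f x x = 0.
Proof.
move=> sf hx; have := sf _ _ _ _ hx hx; rewrite /= expr0 mul1r => /eqP.
by rewrite -addr_eq0 -mulr2n mulrn_eq0 /= => /eqP.
Qed.

Lemma vbr_even x : x \in P false -> [x, x] = 0.
Proof.
move=> hx; have := vbr_skew hx hx; rewrite /= expr0 scale1r => /eqP.
rewrite -addr_eq0 -mulr2n -scaler_nat scaler_eq0 pnatr_eq0 /=.
by move/eqP.
Qed.

Lemma eval_at_subproof z :
  exists g : 'Hom(form, 'Hom(V, K^o)), forall f, g f = f z.
Proof.
by apply: lfun_exists => a f g; rewrite add_lfunE scale_lfunE.
Qed.

Definition eval_at z : 'Hom(form, 'Hom(V, K^o)) := sval (cid (eval_at_subproof z)).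

Lemma eval_atE z f y : eval_at z f y = fval f z y.
Proof. by rewrite /eval_at; case: cid => g /= ->. Qed.

Lemma memv_addlineP (J : {vspace V}) z x :
  reflect (exists2 j, j \in J & exists c, x = j + c *: z) (x \in (J + <[z]>)%VS).
Proof.
apply: (iffP memv_addP) => [[j jJ [_ /vlineP [c ->] ->]]|[j jJ [c ->]]].
  by exists j => //; exists c.
by exists j => //; exists (c *: z) => //; apply/vlineP; exists c.
Qed.

Lemma vanishes_addline J z f : vanishes J f ->
  vanishes (J + <[z]>)%VS f <-> eval_at z f = 0.
Proof.
move=> vf; split=> [h|h x y /memv_addlineP [j jJ [c ->]]].
  by apply/lfunP => y; rewrite eval_atE zero_lfunE h // memvE addvSr.
by rewrite fvalDl vf // fvalZl -eval_atE h zero_lfunE mulr0 addr0.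
Qed.

(** Rank-nullity for [eval_at z], whose kernel consists of the forms that vanish on the larger
    space. *)
Lemma dim_skew_forms_step J z : \dim (skew_forms J) =
  (\dim (skew_forms (J + <[z]>)) + \dim (eval_at z @: skew_forms J))%N.
Proof.
rewrite -(limg_ker_dim (eval_at z) (skew_forms J)); congr (\dim _ + _)%N.
apply/vspaceP => f; rewrite memv_cap memv_ker; apply/andP/idP.
  move=> [/skew_formsP [sf vf] /eqP h]; apply/skew_formsP; split=> //.
  exact/vanishes_addline.
move=> /skew_formsP [sf vf].
have vJ : vanishes J f by move=> x y xJ; apply: vf; apply: subvP xJ; apply: addvSl.
by split; [apply/skew_formsP | exact/eqP/(vanishes_addline z vJ)].
Qed.

Lemma dim_cocycles_step J z : \dim (cocycles J) =
  (\dim (cocycles (J + <[z]>)) + \dim (eval_at z @: cocycles J))%N.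
Proof.
rewrite -(limg_ker_dim (eval_at z) (cocycles J)); congr (\dim _ + _)%N.
apply/vspaceP => f; rewrite memv_cap memv_ker; apply/andP/idP.
  move=> [/cocyclesP [sf cf vf] /eqP h]; apply/cocyclesP; split=> //.
  exact/vanishes_addline.
move=> /cocyclesP [sf cf vf].
have vJ : vanishes J f by move=> x y xJ; apply: vf; apply: subvP xJ; apply: addvSl.
by split; [apply/cocyclesP | exact/eqP/(vanishes_addline z vJ)].
Qed.

Lemma graded_addline J b z : graded J -> z \in P b -> graded (J + <[z]>)%VS.
Proof.
move=> gJ hz a _ /memv_addlineP [j jJ [c ->]].
rewrite linearD linearZ /=; apply/memv_addlineP; exists (vpart a j); first exact: gJ.
have [->|nab] := eqVneq a b; first by exists c; rewrite (vpart_id hz).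
have -> : a = ~~ b by move: nab; case: a b {hz} => [] [].
by exists 0; rewrite (vpart_other hz) scaler0 scale0r.
Qed.

Lemma dim_addline (J : {vspace V}) z : z \notin J ->
  \dim (J + <[z]>)%VS = (\dim J).+1.
Proof.
move=> zJ; rewrite dimv_disjoint_sum.
  rewrite dim_vline; case: eqP zJ => [->|_ _]; first by rewrite mem0v.
  by rewrite addn1.
apply/eqP; rewrite -subv0; apply/subvP => w /memv_capP [wU /vlineP [c wE]].
move: wU; rewrite wE memv0; have [->|c0] := eqVneq c 0; first by rewrite scale0r eqxx.
by move=> /(memvZ c^-1); rewrite scalerA mulVf // scale1r (negbTE zJ).
Qed.

Lemma homogeneous_outside (J U : {vspace V}) : graded U -> ~~ (U <= J)%VS ->
  exists b z, [/\ z \in P b, z \in U & z \notin J].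
Proof.
move=> gU /subvPn [x xU xJ].
have [h|h] := boolP (vpart false x \in J).
  exists true, (vpart true x); split; rewrite ?vpart_mem ?gU //.
  by apply: contra xJ => h'; rewrite [x]vpartE memvD.
by exists false, (vpart false x); split; rewrite ?vpart_mem ?gU.
Qed.

Lemma graded_fullv : graded fullv. Proof. by move=> b x _; apply: memvf. Qed.

Lemma homogeneous_functional J b z : graded J -> z \in P b -> z \notin J ->
  exists f : 'Hom(V, K^o), [/\ forall u, u \in J -> f u = 0,
    forall u, u \in P (~~ b) -> f u = 0 & f z = 1].
Proof.
move=> gJ hz zJ.
have zU : z \notin (J + P (~~ b))%VS.
  apply: contra zJ => /memv_addP [j jJ [u uP zE]].
  have := congr1 (vpart b) zE; rewrite linearD /= vpart_id //.
  by rewrite -{2}[b]negbK vpart_other // addr0 => ->; apply: gJ.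
have [f [fU fz]] := separating_functional zU.
exists f; split=> // u hu; apply: fU; first by apply: subvP hu; apply: addvSl.
by apply: subvP hu; apply: addvSr.
Qed.

(** For odd [b] this is the parity automorphism. It provides the sign in the wedge product of a
    functional [z] of parity [b] with any [f]: where [z y] is nonzero, [y] has parity [b], so
    exchanging [x] and [y] costs the sign of [twist b] on [x]. *)
Definition twist (b : bool) (x : V) : V :=
  if b then vpart false x - vpart true x else x.

Arguments twist : simpl never.

Lemma twist_linear b : linear (twist b).
Proof.
by case: b => // a x y; rewrite /twist (linearP (vpart false)) (linearP (vpart true)) /= scalerBr opprD addrACA.
Qed.

Lemma twist_graded J b x : graded J -> x \in J -> twist b x \in J.
Proof. by case: b => // gJ xJ; rewrite /twist memvB ?gJ. Qed.

Lemma twist_par a x : x \in P a -> twist true x = (-1) ^+ a *: x.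
Proof.
move=> hx; rewrite /twist; case: a hx => hx.
  by rewrite (vpart_id hx) (vpart_other hx) expr1 scaleN1r sub0r.
by rewrite (vpart_id hx) (vpart_other hx) expr0 scale1r subr0.
Qed.

Lemma wedge_exists b (z f : 'Hom(V, K^o)) :
  exists g : form, forall x y, fval g x y = z x * f y - z y * f (twist b x).
Proof.
apply: bilinear_exists => [y|x] a u v.
  rewrite twist_linear !linearP /= /GRing.scale /=; ring.
rewrite !linearP /= /GRing.scale /=; ring.
Qed.

Lemma wedge_skew b (z f : 'Hom(V, K^o)) g :
  (forall u, u \in P (~~ b) -> z u = 0) ->
  (forall x y, fval g x y = z x * f y - z y * f (twist b x)) -> skew_form g.
Proof.
move=> hz hg a c x y hx hy; rewrite !hg.
case: b hz {hg} => hz.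
  rewrite (twist_par hx) (twist_par hy) !linearZ /= /GRing.scale /=.
  case: a hx => hx; case: c hy => hy; rewrite /= ?expr0 ?expr1.
  - ring.
  - by rewrite (hz y) //; ring.
  - by rewrite (hz x) //; ring.
  - by rewrite (hz x) // (hz y) //; ring.
case: a hx => hx; case: c hy => hy; rewrite /= ?expr0 ?expr1; try ring.
by rewrite (hz x) // (hz y) //; ring.
Qed.

(** A skew form is alternating at an even [z] but unconstrained at an odd one, whence the two cases.
    All remaining functionals are realized by wedge products with a functional dual to [z]. *)
Lemma eval_skew_forms J b z : graded J -> z \in P b -> z \notin J ->
  (eval_at z @: skew_forms J =
   annihilator (if b then J else J + <[z]>))%VS.
Proof.
move=> gJ hz zJ; apply/vspaceP => f; apply/idP/idP.
  move=> /memv_imgP [g /skew_formsP [sg vg] ->]; apply/annihilatorP => u uJ.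
  rewrite eval_atE.
  case: b hz uJ => hz; first exact: vanishes_right.
  move=> /memv_addlineP [j jJ [c ->]]; rewrite fvalDr fvalZr.
  by rewrite (vanishes_right _ gJ) // (skew_even sg hz) mulr0 addr0.
move=> /annihilatorP fJ; apply/memv_imgP.
have [zs [zsJ zsP zsz]] := homogeneous_functional gJ hz zJ.
(* For odd [z] the wedge of [zs] and [h] takes the value [h y + zs y * h z] at [z] and [y]; the
   correction by half of [f z] turns this into [f y]. *)
pose h : 'Hom(V, K^o) := if b then f - (f z / 2 : K) *: zs else f.
have hJ u : u \in J -> h u = 0.
  move=> uJ; rewrite /h; case: b {hz zsP h} fJ => fJ.
    by rewrite add_lfunE opp_lfunE scale_lfunE fJ // zsJ // scaler0 subr0.
  by apply: fJ; apply: subvP uJ; apply: addvSl.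
have [g hg] := wedge_exists b zs h.
exists g.
  apply/skew_formsP; split; first exact: wedge_skew hg.
  by move=> x y xJ; rewrite hg zsJ // mul0r hJ ?twist_graded // mulr0 subr0.
apply/lfunP => y; rewrite eval_atE hg zsz mul1r /h.
case: b hz {zsP h hJ hg} fJ => hz fJ.
  rewrite (twist_par hz) expr1 scaleN1r linearN /= !add_lfunE !opp_lfunE.
  by rewrite !scale_lfunE zsz /GRing.scale /=; field.
by rewrite /twist /= [f z]fJ ?mulr0 ?subr0 // memvE addvSr.
Qed.

Definition odd_codim (J : {vspace V}) : nat := (\dim (P true) - \dim (J :&: P true))%N.

Lemma dim_addline_odd J b z : graded J -> z \in P b -> z \notin J ->
  \dim ((J + <[z]>) :&: P true)%VS = (\dim (J :&: P true)%VS + b)%N.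
Proof.
move=> gJ hz zJ; case: b hz => hz.
  have le1 : (<[z]> <= P true)%VS by rewrite -memvE.
  rewrite addvC -vspace_modl // addvC dim_addline ?addn1 //.
  by apply: contra zJ => /memv_capP [].
rewrite addn0; congr (\dim _); apply/vspaceP => u; apply/memv_capP/memv_capP => -[].
  move=> /memv_addlineP [j jJ [c uE]] uP; split=> //.
  have := congr1 (vpart false) uE.
  rewrite linearD linearZ /= (vpart_other uP) (vpart_id hz) => /esym/eqP.
  rewrite addr_eq0 => /eqP h; have [c0|c0] := eqVneq c 0.
    by rewrite uE c0 scale0r addr0.
  have : c *: z \in J by rewrite -memvN -h gJ.
  by move=> /(memvZ c^-1); rewrite scalerA mulVf // scale1r (negbTE zJ).
by move=> uJ uP; split=> //; apply: subvP uJ; apply: addvSl.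
Qed.

(** The number is the dimension of the super exterior square of the quotient by [J]: odd directions
    have free diagonal values, and each adds one to the binomial coefficient. *)
Lemma dim_skew_forms J : graded J -> \dim (skew_forms J) =
  ('C(\dim {:V} - \dim J, 2) + odd_codim J)%N.
Proof.
move=> gJ; have [n hn] : exists n, n = (\dim {:V} - \dim J)%N by eexists.
have dJ (U : {vspace V}) : (\dim U <= \dim {:V})%N by rewrite dimvS ?subvf.
have dJP (U : {vspace V}) : (\dim (U :&: P true) <= \dim (P true))%N.
  by rewrite dimvS ?capvSr.
elim: n J gJ hn => [|n IHn] J gJ hn.
  have JE : J = fullv by apply/eqP; rewrite eqEdim subvf; lia.
  rewrite JE subnn /odd_codim capfv subnn; apply/eqP; rewrite dimv_eq0 -subv0.
  apply/subvP => f /skew_formsP [_ vf]; rewrite memv0; apply/eqP/lfunP => x.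
  by apply/lfunP => y; rewrite !zero_lfunE; apply: vf; apply: memvf.
have /(homogeneous_outside graded_fullv) [b [z [hz _ zJ]]] : ~~ (fullv <= J)%VS.
  by apply: contraPN hn => /dimvS; lia.
have dJz := dim_addline zJ; have oJz := dim_addline_odd gJ hz zJ.
rewrite (dim_skew_forms_step J z) IHn; last by lia.
2: exact: graded_addline hz.
rewrite (eval_skew_forms gJ hz zJ) -hn; have -> : (\dim {:V} - \dim (J + <[z]>) = n)%N by lia.
have := dJP (J + <[z]>)%VS; rewrite /odd_codim oJz binS bin1.
case: b hz oJz => hz oJz /=.
  by have := dim_annihilator J; have := dJ J; move: hn; dimlia.
by have := dim_annihilator (J + <[z]>)%VS; have := dJ J; move: hn dJz; dimlia.
Qed.

End Cocycles.

(** * The derived subalgebra and the restrictions it imposes on cocycles *)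

Section Derived.
Variables (K : numFieldType) (V : vectType K) (A : vectSuper V).
Local Notation P := (vpar A).
Local Notation "[ x , y ]" := (vbr A x y) (at level 0).
Local Notation form := 'Hom(V, 'Hom(V, K^o)).
Local Notation graded := (graded A).
Local Notation vpart := (vpart A).

Let brackets : set V := linear_span [set vbr A x y | x in setT & y in setT].

Definition derived : {vspace V} := vspace_of brackets.

Lemma derivedP u : u \in derived <-> bracket_space (L := super_of A) setT setT u.
Proof. by rewrite -(mem_vspace_of u (linear_span_subspace _)). Qed.

Lemma vbr_derived x y : [x, y] \in derived.
Proof.
apply/derivedP; apply: mem_linear_span; exists x => //; by exists y.
Qed.

Lemma derived_ind (Q : set V) : subspace Q -> (forall x y, Q [x, y]) ->
  forall u, u \in derived -> Q u.
Proof.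
move=> sQ hQ u /derivedP; apply: linear_span_min => // _ [x _ [y _ <-]].
exact: hQ.
Qed.

Lemma vpart_vbr (Q : set V) b x y : subspace Q ->
  (forall a c, Q [vpart a x, vpart c y]) -> Q (vpart b [x, y]).
Proof.
move=> sQ hQ; have h a c : Q (vpart b [vpart a x, vpart c y]).
  have hp := vbr_par (vpart_mem A a x) (vpart_mem A c y).
  have [->|nb] := eqVneq b (a (+) c); first by rewrite vpart_id.
  have -> : b = ~~ (a (+) c) by case: b (a (+) c) nb => [] [].
  by rewrite vpart_other //; apply: subspace0.
rewrite [in [x, y]](vpartE A x) [in [_, y]](vpartE A y) vbrDl !vbrDr !linearD /=.
by do 3 apply: subspaceD => //.
Qed.

Lemma derived_graded : graded derived.
Proof.
move=> b; apply: (@derived_ind (fun u => vpart b u \in derived)) => [|x y].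
  split=> [|a u v hu hv]; first by rewrite linear0 mem0v.
  by rewrite linearP /= memvD ?memvZ.
apply: (vpart_vbr _ (vspace_subspace derived)) => a c; exact: vbr_derived.
Qed.

Lemma central_series_graded k b x :
  central_series (super_of A) k x -> central_series (super_of A) k (vpart b x).
Proof.
elim: k b x => [//|k IHk] b x.
have sS : subspace (central_series (super_of A) k.+1) := linear_span_subspace _.
have sQ : subspace (fun x => central_series (super_of A) k.+1 (vpart b x)).
  split=> [|a u v hu hv]; first by rewrite linear0; apply: subspace0.
  by rewrite linearP; apply: (sS.2 a).
apply: (linear_span_min sQ) => _ [u hu [v _ <-]].
apply: (vpart_vbr _ sS) => a c; apply: mem_linear_span.
by exists (vpart a u); [exact: IHk | exists (vpart c v)].
Qed.

(** Take the first term of the central series contained in [U]. It is neither the whole algebra nor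
    its derived subalgebra, so the preceding term lies in [derived], is not contained in [U], and
    has all its brackets in [U]. As this term is graded, a homogeneous [z] can be chosen. *)
Lemma nilpotent_chain (U : {vspace V}) :
  lie_nilpotent (super_of A) -> ~~ (derived <= U)%VS ->
  exists b z, [/\ z \in P b, z \in derived, z \notin U & forall y, [z, y] \in U].
Proof.
move=> [k hk] /subvPn [d dD dU].
pose S := central_series (super_of A).
pose Q j := `[< S j `<=` [set x | x \in U] >].
have exQ : exists j, Q j.
  by exists k; apply/asboolP => x; rewrite /S hk => ->; rewrite /= mem0v.
case: (ex_minnP exQ) => -[|[|j]] /asboolP Sj jmin.
- by move/negP: dU; case; apply: Sj.
- by move/negP: dU; case; apply: Sj; apply/derivedP.
have [u Su uU] : exists2 u, S j.+1 u & u \notin U.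
  apply: contrapT => h; have /jmin : Q j.+1; last by rewrite ltnn.
  apply/asboolP => x Sx; apply: contrapT => xU; apply: h; exists x => //.
  exact/negP.
have SD x : S j.+1 x -> x \in derived.
  move=> h; apply/derivedP; apply: linear_span_min h; first exact: linear_span_subspace.
  move=> _ [v _ [w _ <-]]; apply: mem_linear_span; exists v => //; by exists w.
have SU x y : S j.+1 x -> [x, y] \in U.
  by move=> Sx; apply: Sj; apply: mem_linear_span; exists x => //; exists y.
have [h|h] := boolP (vpart false u \in U).
  have Su1 : S j.+1 (vpart true u) by apply: central_series_graded.
  exists true, (vpart true u); split; rewrite ?vpart_mem ?SD //; last by move=> y; apply: SU.
  by apply: contra uU => h'; rewrite [u](vpartE A) memvD.
have Su0 : S j.+1 (vpart false u) by apply: central_series_graded.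
exists false, (vpart false u); by split; rewrite ?vpart_mem ?SD // => y; apply: SU.
Qed.

Lemma lin_homogeneous0 (T : lmodType K) (g : V -> T) : linear g ->
  (forall b x, x \in P b -> g x = 0) -> forall x, g x = 0.
Proof.
move=> gl h x; rewrite [x](vpartE A) (linD gl) !(h _ _ (vpart_mem _ _ _)).
by rewrite addr0.
Qed.

(** Each term of the cocycle identity has a bracket among its arguments, so the identity reads 0 =
    0. *)
Lemma skew_forms_derived : skew_forms A derived = cocycles A derived.
Proof.
apply/vspaceP => f; apply/idP/idP; last first.
  by move=> /cocyclesP [sf cf vf]; apply/skew_formsP.
move=> /skew_formsP [sf vf]; apply/cocyclesP; split=> // a b x y z hx hy.
rewrite !(vanishes_right _ derived_graded sf vf (vbr_derived _ _)).
by rewrite vf ?vbr_derived // mulr0 addr0.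
Qed.

Section CentralElement.
Variables (I : {vspace V}) (b : bool) (z : V).
Hypotheses (gI : graded I) (hz : z \in P b) (zI : forall y, [z, y] \in I).

(** In the identity for [z], [x], [y], both terms on the right contain a bracket with [z], which
    lies in [I]. *)
Lemma cocycle_central f u : f \in cocycles A I -> u \in derived -> fval f z u = 0.
Proof.
move=> /cocyclesP [sf cf vf]; apply: (@derived_ind (fun u => fval f z u = 0)).
  split=> [|a v w hv hw]; first exact: fval0r.
  by rewrite fvalDr fvalZr hv hw mulr0 addr0.
move=> x y; move: x.
apply: (homogeneous_ind (A := A)) => [v w hv hw|a x hx].
  by rewrite vbrDl fvalDr hv hw addr0.
by rewrite (cf b a) // vf // (vanishes_right _ gI) // mulr0 addr0.
Qed.

Lemma eval_central_sub : (eval_at z @: cocycles A I <= annihilator derived)%VS.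
Proof.
apply/subvP => g /memv_imgP [f hf ->]; apply/annihilatorP => u uD.
by rewrite eval_atE cocycle_central.
Qed.

Lemma dim_cocycles_central_le : (\dim (cocycles A I) <=
  \dim (cocycles A (I + <[z]>)) + (\dim {:V} - \dim derived))%N.
Proof.
rewrite (dim_cocycles_step A I z) leq_add2l; apply: leq_trans (dimvS eval_central_sub) _.
have := dim_annihilator derived; dimlia.
Qed.

(* If the bound of dim_cocycles_central_le is attained, the z-values of
   cocycles separate the points outside the derived subalgebra. *)
Lemma dim_cocycles_central_lt w : w \notin derived ->
  (forall f, f \in cocycles A I -> fval f z w = 0) ->
  (\dim (cocycles A I) <
   \dim (cocycles A (I + <[z]>)) + (\dim {:V} - \dim derived))%N.
Proof.
move=> wD hw; rewrite (dim_cocycles_step A I z) ltn_add2l.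
have sub : (eval_at z @: cocycles A I <= annihilator (derived + <[w]>))%VS.
  apply/subvP => g /memv_imgP [f hf ->]; apply/annihilatorP.
  move=> _ /memv_addlineP [u uD [c ->]].
  by rewrite linearD linearZ /= !eval_atE cocycle_central // hw // scaler0 addr0.
apply: leq_ltn_trans (dimvS sub) _.
have := dim_annihilator (derived + <[w]>); have := dim_addline wD.
have := dimvS (subvf (derived + <[w]>)%VS); dimlia.
Qed.

End CentralElement.

(** * The last step: the derived subalgebra is a line modulo [I] *)

Section OneDimensionalQuotient.
Variables (I : {vspace V}) (b : bool) (z : V) (phi : 'Hom(V, K^o)).
Hypotheses (gI : graded I) (hz : z \in P b) (zI : z \notin I).
Hypothesis derivedE : derived = (I + <[z]>)%VS.
Hypothesis derived_ideal : forall u y, u \in derived -> [u, y] \in I.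
Hypothesis phiI : forall u, u \in I -> phi u = 0.
Hypothesis phiP : forall u, u \in P (~~ b) -> phi u = 0.
Hypothesis phiz : phi z = 1.

(** Modulo [I] the bracket of [x] and [y] is [om x y *: z], so this form carries the whole structure
    of the quotient. *)
Let om x y : K := phi [x, y].

Let omDl x y w : om (x + y) w = om x w + om y w.
Proof. by rewrite /om vbrDl linearD. Qed.
Let omDr x y w : om w (x + y) = om w x + om w y.
Proof. by rewrite /om vbrDr linearD. Qed.
Let omZl c x w : om (c *: x) w = c * om x w.
Proof. by rewrite /om vbrZl linearZ. Qed.
Let omZr c x w : om w (c *: x) = c * om w x.
Proof. by rewrite /om vbrZr linearZ. Qed.
Let omNl x w : om (- x) w = - om x w.
Proof. by rewrite /om vbrNl linearN. Qed.
Let omNr x w : om w (- x) = - om w x.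
Proof. by rewrite /om vbrNr linearN. Qed.

Let om_skew a c x y : x \in P a -> y \in P c ->
  om x y = - ((-1) ^+ (a && c) * om y x).
Proof. by move=> hx hy; rewrite /om (vbr_skew hx hy) linearN linearZ. Qed.

Let om_par x y a c : x \in P a -> y \in P c -> a (+) c != b -> om x y = 0.
Proof.
move=> hx hy h; apply: phiP; have -> : ~~ b = a (+) c by case: b (a (+) c) h => [] [].
exact: vbr_par.
Qed.

Lemma functional_derived u : u \in derived -> u - (phi u : K) *: z \in I.
Proof.
rewrite derivedE => /memv_addlineP [j jI [c ->]].
have -> : phi (j + c *: z) = c :> K; last by rewrite addrK.
by rewrite linearD linearZ /= (phiI jI) phiz add0r /GRing.scale /= mulr1.
Qed.

Section Values.
Variable f : form.
Hypothesis hf : f \in cocycles A I.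

Let fvanish u y : u \in I -> fval f u y = 0.
Proof. by move=> uI; have /cocyclesP [_ _] := hf; apply. Qed.

Lemma fval_derivedl u w : u \in derived -> fval f u w = (phi u : K) * fval f z w.
Proof.
move=> uD; rewrite -fvalZl -[u in LHS](subrK ((phi u : K) *: z)) fvalDl.
by rewrite fvanish ?add0r // functional_derived.
Qed.

Lemma fval_derivedr u w : u \in derived -> fval f w u = (phi u : K) * fval f w z.
Proof.
move=> uD; rewrite -fvalZr -[u in LHS](subrK ((phi u : K) *: z)) fvalDr.
have /cocyclesP [sf cf vf] := hf.
by rewrite (vanishes_right _ gI) ?add0r // functional_derived.
Qed.

(** The cocycle identity with every bracket replaced by a multiple of [z]. Once [om x y] is nonzero
    it confines [fval f z] to the span of [om x] and [om y]. *)
Lemma cocycle_om a c x y w : x \in P a -> y \in P c ->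
  om x y * fval f z w =
  om y w * fval f x z - (-1) ^+ (a && c) * (om x w * fval f y z).
Proof.
move=> hx hy; have /cocyclesP [sf cf vf] := hf.
have e1 : fval f x [y, w] = om y w * fval f x z := fval_derivedr x (vbr_derived y w).
have e2 : fval f y [x, w] = om x w * fval f y z := fval_derivedr y (vbr_derived x w).
have e3 : fval f [x, y] w = om x y * fval f z w := fval_derivedl w (vbr_derived x y).
by have := cf _ _ _ _ w hx hy; rewrite e1 e2 e3 => ->; rewrite addrK.
Qed.

Lemma fvalC a x : x \in P a -> fval f x z = - ((-1) ^+ (a && b) * fval f z x).
Proof. by move=> hx; have /cocyclesP [sf _ _] := hf; apply: sf. Qed.

End Values.

Lemma om_neq0 : exists a c x y, [/\ x \in P a, y \in P c & om x y != 0].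
Proof.
apply: contrapT => h.
have om0 x y : om x y = 0.
  move: x; apply: (homogeneous_ind (A := A)) => [u v hu hv|a x hx].
    by rewrite omDl hu hv addr0.
  move: y; apply: (homogeneous_ind (A := A)) => [u v hu hv|c y hy].
    by rewrite omDr hu hv addr0.
  by apply/eqP/negPn/negP => xy; apply: h; exists a, c, x, y.
have : phi z = 0.
  apply: (@derived_ind (fun u => phi u = 0)) => [|x y|].
  - by split=> [|c u v hu hv]; rewrite ?linear0 // linearP /= hu hv scaler0 addr0.
  - exact: om0.
  - by rewrite derivedE memvE addvSr.
by rewrite phiz => /eqP; rewrite oner_eq0.
Qed.

Let ev := (eval_at z @: cocycles A I)%VS.

Let dim_ev : \dim (cocycles A I) = (\dim (skew_forms A derived) + \dim ev)%N.
Proof. by rewrite (dim_cocycles_step A I z) -derivedE skew_forms_derived. Qed.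

Let ev0 : (forall f w, f \in cocycles A I -> fval f z w = 0) ->
  \dim (cocycles A I) = \dim (skew_forms A derived).
Proof.
move=> h; rewrite dim_ev; have -> : ev = 0%VS; last by rewrite dimv0 addn0.
apply/eqP; rewrite -subv0; apply/subvP => g /memv_imgP [f hf ->].
by rewrite memv0; apply/eqP/lfunP => w; rewrite eval_atE zero_lfunE h.
Qed.

Let functional_om y : exists g : 'Hom(V, K^o), forall w, g w = om w y.
Proof. by apply: (@lfun_exists _ _ K^o) => c u v; rewrite omDl omZl. Qed.
Let functional_omr y : exists g : 'Hom(V, K^o), forall w, g w = om y w.
Proof. by apply: (@lfun_exists _ _ K^o) => c u v; rewrite omDr omZr. Qed.

(** For odd [z] the form [om] pairs even elements with odd ones. Taking [w = y] odd in [cocycle_om]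
    gives [2 * om x y * fval f y z = 0], so only the functional [om y] remains. *)
Lemma dim_cocycles_odd : b = true ->
  (\dim (cocycles A I) <= \dim (skew_forms A derived) + 1)%N.
Proof.
move=> bE; rewrite dim_ev leq_add2l.
have [x [y [hx hy xy]]] : exists x y, [/\ x \in P false, y \in P true & om x y != 0].
  have [a [c [x [y [hx hy xy]]]]] := om_neq0.
  case: a hx => hx; case: c hy => hy; try by rewrite (om_par hx hy) ?bE ?eqxx in xy.
    exists y, x; split=> //; move: xy; rewrite (om_skew hx hy) /= expr0 mul1r oppr_eq0.
    by [].
  by exists x, y.
have [g hg] := functional_omr y.
have sub : (ev <= <[g]>)%VS.
  apply/subvP => _ /memv_imgP [f hf ->]; apply/vlineP.
  have fzy : fval f y z = 0.
    have := cocycle_om hf y hx hy; rewrite (om_par hy hy) ?bE // mul0r /= expr0 mul1r.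
    rewrite sub0r [fval f y z](fvalC hf hy) bE /= expr1 mulN1r opprK => /eqP.
    by rewrite -addr_eq0 -mulrDr -mulr2n mulf_eq0 (negbTE xy) mulrn_eq0 => /eqP.
  exists (fval f x z / om x y); apply/lfunP => w; rewrite eval_atE scale_lfunE hg.
  have := cocycle_om hf w hx hy; rewrite fzy !mulr0 subr0 /GRing.scale /= => h.
  by apply: (mulfI xy); rewrite h; field.
by apply: leq_trans (dimvS sub) _; rewrite dim_vline leq_b1.
Qed.

(** Polarization yields an odd [e] with [om e e != 0]. The identity at [e, e, e] becomes
    [3 * om e e * fval f z e = 0], and then the identity at [e, e, w] gives [fval f z w = 0]. *)
Lemma dim_cocycles_odd_bracket x y : b = false -> x \in P true -> y \in P true ->
  om x y != 0 -> \dim (cocycles A I) = \dim (skew_forms A derived).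
Proof.
move=> bE hx hy xy.
have [e he ee] : exists2 e, e \in P true & om e e != 0.
  have [ex|ex] := eqVneq (om x x) 0; last by exists x.
  have [ey|ey] := eqVneq (om y y) 0; last by exists y.
  exists (x + y); first by rewrite memvD.
  rewrite omDl !omDr ex ey add0r addr0 (om_skew hy hx) /= expr1 mulN1r opprK.
  by rewrite -mulr2n mulrn_eq0 negb_or.
apply: ev0 => f w hf.
have h v : om e e * fval f z v = - (2 * om e v * fval f z e).
  rewrite (cocycle_om hf v he he) (fvalC hf he) bE /= expr1 expr0; ring.
have fze : fval f z e = 0.
  have /eqP := h e; rewrite -addr_eq0.
  have -> : om e e * fval f z e + 2 * om e e * fval f z e = 3 * om e e * fval f z e by ring.
  by rewrite !mulf_eq0 (negbTE ee) pnatr_eq0 /= => /eqP.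
by apply: (mulfI ee); rewrite h fze !mulr0 oppr0.
Qed.

(* The form phi [x, y] is even of rank 2, i.e. it is the wedge product of
   phi [., y] and phi [x, .] as soon as phi [x, y] = 1. *)
Definition rank_two : Prop :=
  (forall u v, u \in P true -> phi [u, v] = 0) /\
  forall x y, x \in P false -> y \in P false -> phi [x, y] = 1 ->
  forall u v, phi [u, v] = (phi [u, y] : K) * phi [x, v] - (phi [v, y] : K) * phi [x, u].

Let cocycle_even : b = false -> forall x y f w, x \in P false -> y \in P false ->
  om x y = 1 -> f \in cocycles A I ->
  fval f z w = om x w * fval f z y - om y w * fval f z x.
Proof.
move=> bE x y f w hx hy xy hf; have := cocycle_om hf w hx hy.
rewrite xy mul1r => ->; rewrite (fvalC hf hx) (fvalC hf hy) bE /= expr0; ring.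
Qed.

(** Both functionals occur. The cocycle identity for the wedge of [phi] and [g] reduces to the
    vanishing of the wedge of [om] and [g], and this holds for [g] in the span of the two
    functionals whose product is [om]. *)
Lemma dim_cocycles_rank_two : b = false -> rank_two ->
  \dim (cocycles A I) = (\dim (skew_forms A derived) + 2)%N.
Proof.
move=> bE [odd0 rk2]; rewrite dim_ev; congr addn.
have odd0r u v : v \in P true -> om u v = 0.
  move=> hv; move: u; apply: (homogeneous_ind (A := A)) => [u w hu hw|a u hu].
    by rewrite omDl hu hw addr0.
  by rewrite (om_skew hu hv) [om v u]odd0 // mulr0 oppr0.
have [x [y [hx hy xy]]] : exists x y, [/\ x \in P false, y \in P false & om x y = 1].
  have [a [c [x [y [hx hy xy]]]]] := om_neq0.
  case: a hx => hx; first by rewrite /om odd0 ?eqxx in xy.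
  case: c hy => hy; first by rewrite odd0r ?eqxx in xy.
  by exists ((om x y)^-1 *: x), y; split; rewrite ?memvZ // omZl mulVf.
have {}rk2 u v : om u v = om u y * om x v - om v y * om x u by apply: rk2.
have [xs hxs] := functional_om y; have [ys hys] := functional_omr x.
have skew0 u v : om u v = - om v u by rewrite rk2 [om v u]rk2; ring.
have wit (g : 'Hom(V, K^o)) : (exists s t : K, forall w, g w = s * om w y + t * om x w :> K) -> g \in ev.
  move=> [s [t hg]].
  have g_odd u : u \in P true -> g u = 0.
    by move=> hu; rewrite hg (odd0r x) // [om u y]odd0 // !mulr0 addr0.
  have gD u : u \in derived -> g u = 0.
    move=> uD; rewrite hg [om x u]skew0 /om !phiI ?derived_ideal //.
    by rewrite oppr0 !mulr0 addr0.
  have [f hf] := wedge_exists A false phi g.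
  have zD : z \in derived by rewrite derivedE memvE addvSr.
  apply/memv_imgP; exists f; last first.
    by apply/lfunP => w; rewrite eval_atE hf phiz mul1r [g (twist _ _ z)]gD // mulr0 subr0.
  apply/cocyclesP; split.
  - by apply: wedge_skew hf; rewrite -bE.
  - move=> a c u v w hu hv; rewrite !hf /twist /= ![g [_, _]]gD ?vbr_derived //.
    rewrite -/(om v w) -/(om u v) -/(om u w) !mulr0 !sub0r subr0.
    have idt : om u v * g w - om u w * g v + om v w * g u = 0.
      by rewrite (rk2 u v) (rk2 u w) (rk2 v w) !hg; ring.
    have [/andP [at_ ct]|] := boolP (a && c).
      rewrite at_ in hu; rewrite ct in hv.
      rewrite (g_odd u hu) (g_odd v hv) [om u v]odd0 //; ring.
    rewrite expr0 => _; apply/eqP; rewrite -subr_eq0 -[X in _ == X]oppr0 -idt.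
    by apply/eqP; ring.
  - move=> u v uI; rewrite hf (phiI uI) /twist /= (gD u); first by rewrite mul0r mulr0 subr0.
    by rewrite derivedE; apply: subvP uI; apply: addvSl.
have evE : ev = (<[xs]> + <[ys]>)%VS.
  apply/eqP; rewrite eqEsubv subv_add -!memvE; apply/andP; split; last first.
    apply/andP; split; apply: wit.
      by exists 1, 0 => w; rewrite hxs mul1r mul0r addr0.
    by exists 0, 1 => w; rewrite hys mul1r mul0r add0r.
  apply/subvP => _ /memv_imgP [f hf ->].
  apply/memv_addlineP; exists ((fval f z x : K) *: xs); first by rewrite memvZ ?memv_line.
  exists (fval f z y); apply/lfunP => w.
  rewrite eval_atE add_lfunE !scale_lfunE hxs hys (cocycle_even bE w hx hy xy hf).
  rewrite (skew0 y w) /GRing.scale /=; ring.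
rewrite evE dim_addline.
  rewrite dim_vline; case: eqP => // xs0; have := hxs x.
  by rewrite xs0 zero_lfunE xy => /esym/eqP; rewrite oner_eq0.
apply/negP => /vlineP [c ysE]; have := hys y.
rewrite ysE scale_lfunE hxs xy /om vbr_even // linear0 scaler0.
by move/esym/eqP; rewrite oner_eq0.
Qed.

(** When [z] is even, brackets of odd elements vanish under [om] and the rank exceeds 2, [om] has
    two mutually orthogonal hyperbolic pairs, and together they force [fval f z] to be zero. *)
Lemma dim_cocycles_dichotomy :
  (\dim (cocycles A I) <= \dim (skew_forms A derived) + b)%N \/
  [/\ b = false, rank_two &
      \dim (cocycles A I) = (\dim (skew_forms A derived) + 2)%N].
Proof.
case bE : b; first by left; apply: dim_cocycles_odd.
have [rk|nrk] := pselect rank_two; first by right; split=> //; apply: dim_cocycles_rank_two.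
left; rewrite addn0 eq_leq //.
have [[x [y [hx hy xy]]]|h] := pselect (exists x y,
    [/\ x \in P true, y \in P true & om x y != 0]).
  exact: dim_cocycles_odd_bracket hx hy xy.
have odd0 u v : u \in P true -> om u v = 0.
  move=> hu; move: v; apply: (homogeneous_ind (A := A)) => [v w hv hw|[] v hv].
  - by rewrite omDr hv hw addr0.
  - by apply/eqP/negPn/negP => uv; apply: h; exists u, v.
  - by rewrite (om_par hu hv) // bE.
have odd0r u v : v \in P true -> om u v = 0.
  move=> hv; move: u; apply: (homogeneous_ind (A := A)) => [u w hu hw|a u hu].
    by rewrite omDl hu hw addr0.
  by rewrite (om_skew hu hv) odd0 // mulr0 oppr0.
have skew0 u v : om u v = - om v u.
  move: u; apply: (homogeneous_ind (A := A)) => [u w hu hw|[] u hu].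
  - by rewrite omDl omDr hu hw opprD.
  - by rewrite odd0 // odd0r // oppr0.
  move: v; apply: (homogeneous_ind (A := A)) => [v w hv hw|[] v hv].
  - by rewrite omDl omDr hv hw opprD.
  - by rewrite odd0r // odd0 // oppr0.
  by rewrite (om_skew hu hv) expr0 mul1r.
apply: contrapT => hdim; apply: nrk; split=> [u v hu|x y hx hy xy u v].
  exact: odd0.
apply: contrapT => huv; apply: hdim; apply: ev0.
have {}xy : om x y = 1 := xy.
(* The projection onto the orthogonal complement of the hyperbolic pair [x, y]. The defect of the
   rank-two formula at [u, v] is exactly [om (red u) (red v)]. *)
pose red w := w - om w y *: x - om x w *: y.
have xx : om x x = 0 by rewrite /om vbr_even // linear0.
have yy : om y y = 0 by rewrite /om vbr_even // linear0.
have redy w : om (red w) y = 0.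
  by rewrite /red !omDl !omNl !omZl xy yy; ring.
have redx w : om x (red w) = 0.
  by rewrite /red !omDr !omNr !omZr xy xx; ring.
have red_om : om (red u) (red v) != 0.
  have -> : om (red u) (red v) = om u v - (om u y * om x v - om v y * om x u).
    rewrite {2}/red !omDr !omNr !omZr redy [om (red u) x]skew0 redx.
    by rewrite /red !omDl !omNl !omZl [om y v]skew0; ring.
  by rewrite subr_eq0; apply/eqP.
(* Odd elements lie in the radical of [om], so the second pair can be replaced by its even parts, as
   [cocycle_even] requires. *)
have part0 w : om (vpart false w) =1 om w.
  by move=> w'; rewrite [in RHS](vpartE A w) omDl (odd0 (vpart true w)) ?vpart_mem ?addr0.
pose u' := (om (red u) (red v))^-1 *: vpart false (red u).
pose v' := vpart false (red v).
have hu' : u' \in P false by rewrite memvZ ?vpart_mem.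
have hv' : v' \in P false by rewrite vpart_mem.
have uv' : om u' v' = 1.
  have h' : om (vpart false (red u)) (vpart false (red v)) = om (red u) (red v).
    by rewrite part0 skew0 part0 -skew0.
  by rewrite /u' /v' omZl h' mulVf.
have perp w : (forall t, om (red t) w = 0) -> om u' w = 0 /\ om v' w = 0.
  by move=> hw; rewrite /u' /v' omZl !part0 !hw mulr0.
have [u'x v'x] := perp x (fun t => etrans (skew0 _ _) (etrans (congr1 -%R (redx t)) (oppr0 _))).
have [u'y v'y] := perp y redy.
(* The pair [x, y] expresses [fval f z w] through [fval f z x] and [fval f z y]; the pair [u', v'],
   orthogonal to [x] and [y], makes these vanish. *)
move=> f w hf; rewrite (cocycle_even bE w hx hy xy hf).
rewrite (cocycle_even bE x hu' hv' uv' hf) (cocycle_even bE y hu' hv' uv' hf).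
by rewrite u'x v'x u'y v'y; ring.
Qed.

End OneDimensionalQuotient.

End Derived.

(** * Bounds on the cocycles of a nilpotent superalgebra *)

Section Bounds.
Variables (K : numFieldType) (V : vectType K) (A : vectSuper V).
Hypothesis nilA : lie_nilpotent (super_of A).
Local Notation P := (vpar A).
Local Notation "[ x , y ]" := (vbr A x y) (at level 0).
Local Notation D := (derived A).
Local Notation N := (\dim {:V}).

Lemma addline_ideal (I : {vspace V}) b z : (forall u y, u \in I -> [u, y] \in I) ->
  z \in P b -> (forall y, [z, y] \in I) ->
  forall u y, u \in (I + <[z]>)%VS -> [u, y] \in I.
Proof.
move=> hI hz zI _ y /memv_addlineP [j jI [c ->]].
by rewrite vbrDl vbrZl; apply: memvD; [exact: hI | exact/memvZ/zI].
Qed.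

Lemma addline_eqEdim (U W : {vspace V}) z : (U <= W)%VS -> z \in W -> z \notin U ->
  \dim W = (\dim U).+1 -> W = (U + <[z]>)%VS.
Proof.
move=> UW zW zU dW; apply/esym/eqP; rewrite eqEdim subv_add UW -memvE zW /=.
by rewrite dim_addline // dW.
Qed.

(** The lines missing from [I] are added one at a time. Only for the last one is [D] equal to [I +
    <[z]>], and there the dichotomy gives 2 instead of [N - \dim D]. *)
Lemma dim_cocycles_le j (I : {vspace V}) : graded A I -> (forall u y, u \in I -> [u, y] \in I) ->
  (I <= D)%VS -> \dim D = (\dim I + j.+1)%N ->
  (\dim (cocycles A I) <= \dim (skew_forms A D) + 2 + j * (N - \dim D))%N.
Proof.
elim: j I => [|j IHj] I gI hI ID dI.
  have nsub : ~~ (D <= I)%VS by apply: contraPN dI => /dimvS; dimlia.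
  have [b [z [hz zD zI zc]]] := nilpotent_chain nilA nsub.
  have DE : D = (I + <[z]>)%VS by apply: addline_eqEdim; rewrite // dI addn1.
  have [phi [phiI phiP phiz]] := homogeneous_functional gI hz zI.
  have hD u y : u \in D -> [u, y] \in I by rewrite DE; apply: addline_ideal hz zc _ _.
  rewrite mul0n addn0.
  have [h|[_ _ ->] //] := dim_cocycles_dichotomy gI hz DE hD phiI phiP phiz.
  by apply: leq_trans h _; rewrite leq_add2l; case: (b).
have nsub : ~~ (D <= I)%VS by apply: contraPN dI => /dimvS; dimlia.
have [b [z [hz zD zI zc]]] := nilpotent_chain nilA nsub.
apply: leq_trans (dim_cocycles_central_le gI hz zc) _.
have -> : (\dim (skew_forms A D) + 2 + j.+1 * (N - \dim D) =
  \dim (skew_forms A D) + 2 + j * (N - \dim D) + (N - \dim D))%N.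
  by rewrite mulSn addnCA addnC.
rewrite leq_add2r; apply: IHj.
- exact: graded_addline hz.
- move=> u y /(addline_ideal hI hz zc y) h; apply: subvP h; exact: addvSl.
- by rewrite subv_add ID -memvE.
- by rewrite dim_addline // dI addnS addSn.
Qed.

(** * Rigidity for a two-dimensional derived subalgebra *)

Section TwoDimensionalDerived.
Hypothesis dimD : \dim D = 2.
(* This value of \dim (cocycles A 0) amounts to s = 1. *)
Hypothesis dimZ :
  \dim (cocycles A 0%VS) = (\dim (skew_forms A D) + (N - \dim D) + 2 + \dim (D :&: P true))%N.

Let graded0 : graded A 0%VS.
Proof. by move=> b x; rewrite memv0 => /eqP ->; rewrite linear0 mem0v. Qed.

Let line_graded b z : z \in P b -> graded A <[z]>%VS.
Proof. by move=> hz; rewrite -[<[z]>%VS]add0v; apply: graded_addline hz. Qed.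

Lemma derived_over_line b z : z \in P b -> z \in D -> z != 0 ->
  (forall y, [z, y] = 0) -> forall u y, u \in D -> [u, y] \in <[z]>%VS.
Proof.
move=> hz zD z0 zc.
have dz : \dim <[z]> = 1%N by rewrite dim_vline z0.
have nsub : ~~ (D <= <[z]>)%VS.
  by apply: contraPN dimD => /dimvS; move: dz; dimlia.
have [b' [z' [hz' zD' zI' zc']]] := nilpotent_chain nilA nsub.
have DE : D = (<[z]> + <[z']>)%VS.
  by apply: addline_eqEdim; rewrite ?dz.
rewrite DE; apply: addline_ideal hz' zc' => u y /vlineP [c ->].
by rewrite vbrZl zc scaler0 mem0v.
Qed.

(** The central bound for [z] and the dichotomy modulo its line allow at most the value in [dimZ]
    without its last summand, and this only in the rank-two case. Hence both bounds are attained and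
    that summand is 0; [dim_cocycles_central_lt] then gives the last clause. The elements [z], [z']
    and [phi] are kept arbitrary because several choices of them are combined later. *)
Lemma two_dim_derived b z b' z' (phi : 'Hom(V, K^o)) :
  z \in P b -> z \in D -> z != 0 -> (forall y, [z, y] = 0) ->
  z' \in P b' -> z' \in D -> z' \notin <[z]>%VS ->
  phi z = 0 -> phi z' = 1 -> (forall u, u \in P (~~ b') -> phi u = 0) ->
  [/\ b' = false, rank_two A phi, (D :&: P true)%VS = 0%VS &
      forall w, w \notin D -> exists2 f, f \in cocycles A 0%VS & fval f z w != 0].
Proof.
move=> hz zD z0 zc hz' zD' zz' phiz phiz' phiP.
have dz : \dim <[z]> = 1%N by rewrite dim_vline z0.
have DE : D = (<[z]> + <[z']>)%VS.
  by apply: addline_eqEdim; rewrite ?dz.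
have hD := derived_over_line hz zD z0 zc.
have phil u : u \in <[z]>%VS -> phi u = 0.
  by move=> /vlineP [c ->]; rewrite linearZ /= phiz scaler0.
have zc0 y : [z, y] \in 0%VS by rewrite zc mem0v.
have le := dim_cocycles_central_le graded0 hz zc0; rewrite add0v in le.
have [h|[bE rk h]] := dim_cocycles_dichotomy (line_graded hz) hz' DE hD phil phiP phiz'.
  by move: le h dimZ (leq_b1 b'); dimlia.
split=> //.
  by apply/eqP; rewrite -dimv_eq0; move: le h dimZ; dimlia.
move=> w wD; apply: contrapT => hw.
have /(dim_cocycles_central_lt graded0 hz zc0 wD) : forall f,
    f \in cocycles A 0%VS -> fval f z w = 0.
  by move=> f hf; apply/eqP/negPn/negP => fw; apply: hw; exists f.
by rewrite add0v h dimZ; dimlia.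
Qed.

Lemma central_exists : exists b z, [/\ z \in P b, z \in D, z != 0 & forall y, [z, y] = 0].
Proof.
have nsub : ~~ (D <= 0)%VS by apply: contraPN dimD => /dimvS; rewrite dimv0; dimlia.
have [b [z [hz zD z0 zc]]] := nilpotent_chain nilA nsub.
exists b, z; split; rewrite // -?memv0 // => y; apply/eqP; rewrite -memv0; exact: zc.
Qed.

Lemma second_generator b z : z \in P b -> z != 0 ->
  exists b' z', [/\ z' \in P b', z' \in D & z' \notin <[z]>%VS].
Proof.
move=> hz z0; apply: homogeneous_outside; first exact: derived_graded.
by apply: contraPN dimD => /dimvS; rewrite dim_vline z0; dimlia.
Qed.

Lemma derived_even : (D <= P false)%VS.
Proof.
have [b [z [hz zD z0 zc]]] := central_exists.
have [b' [z' [hz' zD' zz']]] := second_generator hz z0.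
have [phi [phiz phiP phiz']] := homogeneous_functional (line_graded hz) hz' zz'.
have [_ _ D1 _] := two_dim_derived hz zD z0 zc hz' zD' zz' (phiz _ (memv_line z)) phiz' phiP.
apply/subvP => u uD; rewrite [u](vpartE A) memvD ?vpart_mem //.
suff -> : vpart A true u = 0 by rewrite mem0v.
apply/eqP; rewrite -memv0 -D1 memv_cap vpart_mem andbT; exact: derived_graded.
Qed.

Lemma derived_even0 u : u \in D -> u \in P true -> u = 0.
Proof. by move=> /(subvP derived_even) h0 h1; apply: vpar_direct h0 h1. Qed.

(* Otherwise an even y outside the derived subalgebra commutes with z', and the
   cocycle identity for z', a, y, where [z', a] is a nonzero multiple of z,
   makes f z y vanish for all cocycles f. *)
Lemma derived_central u y : u \in D -> [u, y] = 0.
Proof.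
have [b [z [hz zD z0 zc]]] := central_exists.
have [b' [z' [hz' zD' zz']]] := second_generator hz z0.
have [phi [phiz phiP phiz']] := homogeneous_functional (line_graded hz) hz' zz'.
have {}phiz : phi z = 0 := phiz _ (memv_line z).
have [b'E [rk1 rk2] D1 sep] := two_dim_derived hz zD z0 zc hz' zD' zz' phiz phiz' phiP.
have hD := derived_over_line hz zD z0 zc.
have dz : \dim <[z]> = 1%N by rewrite dim_vline z0.
have DE : D = (<[z]> + <[z']>)%VS.
  by apply: addline_eqEdim; rewrite ?dz.
suff h : forall a, [z', a] = 0.
  by rewrite DE => /memv_addlineP [_ /vlineP [c ->] [d ->]]; rewrite vbrDl !vbrZl zc h !scaler0 addr0.
apply: (lin_homogeneous0 (vbr_linearr A z')) => -[] a ha.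
  have := vbr_par hz' ha; rewrite b'E /= => h1.
  by apply: derived_even0 => //; apply: vbr_derived.
apply/eqP/negPn/negP => za0.
have /vlineP [g zaE] := hD z' a zD'.
have kerD t : t \in P false -> [z', t] = 0 -> t \in D.
  move=> ht zt; apply/negPn/negP => tD; have [f hf fzt] := sep t tD.
  have /cocyclesP [sf cf vf] := hf.
  have := cf _ _ _ _ t hz' ha; rewrite zt fval0r mulr0 addr0 zaE fvalZl.
  have : [a, t] \in D by apply: vbr_derived.
  rewrite DE => /memv_addlineP [_ /vlineP [c ->] [d ->]].
  (* The left side vanishes: [fval f z' z'] because [z'] is even, [fval f z' z] because [z] is
     central and [z'] lies in [D]. *)
  rewrite fvalDr !fvalZr (skew_even sf) -?b'E // mulr0 addr0.
  rewrite (sf b' b) // (cocycle_central graded0 hz _ hf) //; last by move=> y'; rewrite zc mem0v.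
  rewrite mulr0 oppr0 mulr0 => /esym/eqP; rewrite mulf_eq0 (negbTE fzt) orbF => /eqP g0.
  by move: za0; rewrite zaE g0 scale0r eqxx.
have phiD u' t : u' \in D -> phi [u', t] = 0.
  by move=> u'D; have /vlineP [c ->] := hD u' t u'D; rewrite linearZ /= phiz scaler0.
have phil u' : u' \in <[z]>%VS -> phi u' = 0.
  by move=> /vlineP [c ->]; rewrite linearZ /= phiz scaler0.
have [a1 [c1 [x [y' [hx hy xy]]]]] := om_neq0 DE phiz'.
have even_pair : a1 = false /\ c1 = false.
  case: a1 hx xy => hx; first by rewrite rk1 // eqxx.
  case: c1 hy => hy // /negP []; rewrite (vbr_skew hx hy) linearN linearZ /= rk1 //.
  by rewrite scaler0 oppr0.
case: even_pair => a1E c1E; rewrite a1E in hx; rewrite c1E in hy.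
have /vlineP [al zx] := hD z' x zD'; have /vlineP [be zy] := hD z' y' zD'.
(* Both [[z', x]] and [[z', y']] lie on the line of [z], so this combination commutes with [z'] and
   falls into [D]. Pairing it with [y'] and with [x] under [phi] gives [be = 0] and [al = 0]; then
   [x] itself commutes with [z']. *)
have tD : be *: x - al *: y' \in D.
  apply: kerD; first by rewrite memvB ?memvZ.
  by rewrite vbrDr vbrNr !vbrZr zx zy !scalerA mulrC subrr.
have := phiD _ y' tD; rewrite vbrDl vbrNl !vbrZl vbr_even // scaler0 subr0 linearZ /=.
move/eqP; rewrite scaler_eq0 (negbTE xy) orbF => /eqP be0.
have := phiD _ x tD; rewrite be0 scale0r sub0r vbrNl vbrZl (vbr_skew hy hx) /=.
rewrite expr0 scale1r scalerN opprK linearZ /= => /eqP.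
rewrite scaler_eq0 (negbTE xy) orbF => /eqP al0.
have xD : x \in D by apply: kerD; rewrite // zx al0 scale0r.
have /eqP := phiD x y' xD; by rewrite (negbTE xy).
Qed.

(** For central [w] the identity at [x, y, w] gives [fval f [x, y] w = 0], hence [fval f z w = 0]
    for every cocycle, which the separation clause of [two_dim_derived] permits only inside [D]. *)
Lemma center_sub_derived w : (forall y, [w, y] = 0) -> w \in D.
Proof.
have [b [z [hz zD z0 zc]]] := central_exists.
have [b' [z' [hz' zD' zz']]] := second_generator hz z0.
have [phi [phiz phiP phiz']] := homogeneous_functional (line_graded hz) hz' zz'.
have [_ _ _ sep] := two_dim_derived hz zD z0 zc hz' zD' zz' (phiz _ (memv_line z)) phiz' phiP.
move=> wc; apply/negPn/negP => /sep [f /cocyclesP [sf cf vf] fzw].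
(* Super-skew-symmetry needs homogeneous arguments, so the parts of [w] are shown to be central
   separately: their brackets with a homogeneous [y] have opposite parities and sum to 0. *)
have wc' y : [y, w] = 0.
  move: y; apply: (homogeneous_ind (A := A)) => [u v hu hv|a y hy].
    by rewrite vbrDl hu hv addr0.
  rewrite [w](vpartE A) vbrDr.
  have h c : [vpart A c w, y] = 0.
    have : [w, y] = 0 by [].
    rewrite {1}[w](vpartE A) vbrDl => /eqP; rewrite addr_eq0 => /eqP hE.
    have h0 := vbr_par (vpart_mem A false w) hy; have h1 := vbr_par (vpart_mem A true w) hy.
    have h1' : [vpart A false w, y] \in P (true (+) a) by rewrite hE memvN.
    have z1 : [vpart A false w, y] = 0.
      by case: (a) h0 h1' => /= u v; [apply: vpar_direct v u|apply: vpar_direct u v].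
    case: c => //; apply/eqP; rewrite -oppr_eq0 -hE; exact/eqP.
  by rewrite !(vbr_skew hy (vpart_mem A _ w)) !h !scaler0 !oppr0 addr0.
move: fzw; suff -> : fval f z w = 0 by rewrite eqxx.
apply: (@derived_ind _ _ A (fun u => fval f u w = 0)) zD => [|x y].
  by split=> [|a u v hu hv]; rewrite ?fval0l // fvalDl fvalZl hu hv mulr0 addr0.
move: x; apply: (homogeneous_ind (A := A)) => [u v hu hv|a x hx].
  by rewrite vbrDl fvalDl hu hv addr0.
move: y; apply: (homogeneous_ind (A := A)) => [u v hu hv|c y hy].
  by rewrite vbrDr fvalDl hu hv addr0.
have := cf _ _ _ _ w hx hy; rewrite !wc' !fval0r mulr0 addr0.
by move=> <-.
Qed.

(** A nonzero [[u, y]] with [u] odd could be taken as [z'] in [two_dim_derived], where rank two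
    makes [phi] vanish on brackets with odd elements although [phi z' = 1]. So odd elements are
    central, hence lie in the even space [D]. *)
Lemma odd_part0 : P true = 0%VS.
Proof.
apply/eqP; rewrite -subv0; apply/subvP => u hu; rewrite memv0; apply/eqP.
apply: derived_even0 => //; apply: center_sub_derived => y.
have uyD : [u, y] \in D by apply: vbr_derived.
have [b [z [hz zD z0 zc]]] := central_exists.
have [b' [z' [hz' zD' zz']]] := second_generator hz z0.
have lines t : [u, y] != 0 -> t \in D -> t \notin <[ [u, y] ]>%VS -> False.
  move=> uy0 tD tu.
  have uyP := subvP derived_even _ uyD; have tP := subvP derived_even _ tD.
  have ut : [u, y] \notin <[t]>%VS.
    apply: contra tu => /vlineP [c uyE]; apply/vlineP; exists c^-1.
    rewrite uyE scalerA mulVf ?scale1r //; apply: contraNneq uy0 => c0.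
    by rewrite uyE c0 scale0r.
  have t0 : t != 0 by apply: contraNneq tu => ->; rewrite mem0v.
  have [phi [phiz phiP phiz']] := homogeneous_functional (line_graded tP) uyP ut.
  have [_ [rk _] _ _] := two_dim_derived tP tD t0 (fun y => derived_central y tD) uyP uyD ut
    (phiz _ (memv_line t)) phiz' phiP.
  by move: phiz'; rewrite rk // => /esym/eqP; rewrite oner_eq0.
apply/eqP/negPn/negP => uy0.
have [t [tD tu]] : exists t, t \in D /\ t \notin <[ [u, y] ]>%VS.
  have [b1 [t [_ tD tu]]] := second_generator (subvP derived_even _ uyD) uy0.
  by exists t.
exact: lines t uy0 tD tu.
Qed.

Lemma all_even x : x \in P false.
Proof. by have := memvf x; rewrite -(vpar_span A) odd_part0 addv0. Qed.

Lemma vbrC x y : [x, y] = - [y, x].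
Proof. by rewrite (vbr_skew (all_even x) (all_even y)) /= expr0 scale1r. Qed.

Lemma two_rank_element : exists x y w, [x, y] != 0 /\ [x, w] \notin <[ [x, y] ]>%VS.
Proof.
have [x [y xy]] : exists x y, [x, y] != 0.
  apply: contrapT => h; have : (D <= 0)%VS.
    apply/subvP; apply: derived_ind => [|x y]; first exact: vspace_subspace.
    by rewrite /= memv0; apply/negPn/negP => xy; apply: h; exists x, y.
  by move/dimvS; rewrite dimD dimv0.
have [p [q pq]] : exists p q, [p, q] \notin <[ [x, y] ]>%VS.
  apply: contrapT => h; have : (D <= <[ [x, y] ]>)%VS.
    apply/subvP; apply: derived_ind => [|p q]; first exact: vspace_subspace.
    by apply/negPn/negP => pq; apply: h; exists p, q.
  by move/dimvS; rewrite dimD dim_vline xy.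
(* Either some bracket between {x, y} and {p, q} is nonzero, and then one of
   the four elements works, or x + p does. *)
have mixed s t : [s, t] = [x, y] \/ [s, t] = - [x, y] ->
   forall p q, [p, q] \notin <[ [x, y] ]>%VS -> [s, p] != 0 ->
  exists x y w, [x, y] != 0 /\ [x, w] \notin <[ [x, y] ]>%VS.
  move=> hst p' q' pq' sp.
  have st0 : [s, t] != 0 by case: hst => ->; rewrite ?oppr_eq0.
  have lst : (<[ [s, t] ]> = <[ [x, y] ]>)%VS.
    case: hst => -> //; apply/vspaceP => u; apply/vlineP/vlineP => -[c ->].
      by exists (- c); rewrite scalerN scaleNr.
    by exists (- c); rewrite scalerN scaleNr opprK.
  have [/vlineP [c spE]|h] := boolP ([s, p'] \in <[ [x, y] ]>%VS); last first.
    by exists s, t, p'; rewrite lst.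
  exists p', s, q'; rewrite vbrC oppr_eq0 sp; split=> //.
  apply: contra pq' => /vlineP [d ->]; apply/memvZ; rewrite memvN spE.
  exact/memvZ/memv_line.
have pq2 : [q, p] \notin <[ [x, y] ]>%VS by rewrite vbrC memvN.
have [xp|xp] := eqVneq [x, p] 0; last by apply: (mixed x y (or_introl erefl) p q).
have [xq|xq] := eqVneq [x, q] 0; last by apply: (mixed x y (or_introl erefl) q p).
have yx : [y, x] = - [x, y] by apply: vbrC.
have [yp|yp] := eqVneq [y, p] 0; last by apply: (mixed y x (or_intror yx) p q).
have py : [p, y] = 0 by rewrite vbrC yp oppr0.
by exists (x + p), y, q; rewrite !vbrDl py xq addr0 add0r.
Qed.

(* The three forms p1 [., .], p2 [., .] and (p1 + p2) [., .] all have rank 2,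
   which forces the centralizer of x to be spanned by x and the derived
   subalgebra. *)
Lemma L520_basis : exists x y w, [/\ [y, w] = 0,
  [x, y] != 0, [x, w] \notin <[ [x, y] ]>%VS &
  forall u, exists a b c d e,
    u = a *: x + b *: y + c *: w + d *: [x, y] + e *: [x, w]].
Proof.
have [x [y [w [v0 v'v]]]] := two_rank_element.
set v := [x, y] in v0 v'v *; set v' := [x, w] in v'v *.
have vD : v \in D := vbr_derived A x y; have v'D : v' \in D := vbr_derived A x w.
have gl : graded A <[v]>%VS := line_graded (all_even v).
have v'0 : v' != 0 by apply: contraNneq v'v => ->; rewrite mem0v.
have vv' : v \notin <[v']>%VS.
  apply: contra v'v => /vlineP [c vE]; apply/vlineP; exists c^-1.
  rewrite vE scalerA mulVf ?scale1r //; apply: contraNneq v0 => c0.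
  by rewrite vE c0 scale0r.
have odd0 (phi : 'Hom(V, K^o)) u : u \in P (~~ false) -> phi u = 0.
  by rewrite /= odd_part0 memv0 => /eqP ->; rewrite linear0.
have [p1 [p1v' _ p1v]] := homogeneous_functional (line_graded (all_even v')) (all_even v) vv'.
have [p2 [p2v _ p2v']] := homogeneous_functional gl (all_even v') v'v.
have {}p1v' : p1 v' = 0 := p1v' _ (memv_line v').
have {}p2v : p2 v = 0 := p2v _ (memv_line v).
have [_ [_ rk1] _ _] := two_dim_derived (all_even v') v'D v'0 (fun y => derived_central y v'D)
  (all_even v) vD vv' p1v' p1v (odd0 p1).
have [_ [_ rk2] _ _] := two_dim_derived (all_even v) vD v0 (fun y => derived_central y vD)
  (all_even v') v'D v'v p2v p2v' (odd0 p2).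
(* The functional [p1 + p2] is 0 at [v - v'] and 1 at [v], so these two play the roles of [z] and
   [z'] for the third form. *)
have dD : v - v' \in D by rewrite memvB.
have d0 : v - v' != 0 by rewrite subr_eq0; apply: contraNneq vv' => ->; rewrite memv_line.
have vd : v \notin <[v - v']>%VS.
  apply/negP => /vlineP [c vE]; have := congr1 p2 vE.
  rewrite linearZ linearB /= p2v p2v' sub0r => /esym/eqP.
  rewrite scaler_eq0 oppr_eq0 oner_eq0 orbF => /eqP c0; move: v0.
  by rewrite vE c0 scale0r eqxx.
have p3d : (p1 + p2) (v - v') = 0.
  by rewrite add_lfunE !linearB /= p1v p1v' p2v p2v' subr0 sub0r subrr.
have p3v : (p1 + p2) v = 1 by rewrite add_lfunE p1v p2v addr0.
have [_ [_ rk3] _ _] := two_dim_derived (all_even (v - v')) dD d0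
  (fun y => derived_central y dD) (all_even v) vD vd p3d p3v (odd0 (p1 + p2)).
have DE u : u \in D -> u = (p1 u : K) *: v + (p2 u : K) *: v'.
  have -> : D = (<[v]> + <[v']>)%VS.
    by apply: addline_eqEdim; rewrite ?dim_vline ?v0.
  move=> /memv_addlineP [_ /vlineP [c ->] [d ->]].
  rewrite !linearD !linearZ /= p1v p1v' p2v p2v' !scaler0 addr0 add0r.
  by rewrite /GRing.scale /= !mulr1.
(* If [c] commutes with [x], the first two rank-two formulas make [p1 [c, -]] and [p2 [c, -]]
   multiples of [p1 [x, -]] and [p2 [x, -]]; the third equates the factors, so [c - al *: x] is
   central. *)
have span c : [x, c] = 0 -> exists2 u, u \in D & exists a, c = u + a *: x.
  move=> xc; pose al : K := p1 [c, y].
  have e1 t : p1 [c, t] = al * p1 [x, t] :> K.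
    by rewrite (rk1 x y (all_even x) (all_even y) p1v) xc linear0 mulr0 subr0.
  have e2 t : p2 [c, t] = (p2 [c, w] : K) * p2 [x, t] :> K.
    by rewrite (rk2 x w (all_even x) (all_even w) p2v') xc linear0 mulr0 subr0.
  have e3 : (p1 + p2) [c, w] = ((p1 + p2) [c, y] : K) * (p1 + p2) [x, w] :> K.
    by rewrite (rk3 x y (all_even x) (all_even y) p3v) xc linear0 mulr0 subr0.
  have de : p2 [c, w] = al :> K.
    move: e3; rewrite !add_lfunE (e1 w) (e2 y) -/v -/v' p1v' p2v p2v'.
    by rewrite !mulr0 !add0r addr0 mulr1.
  exists (c - al *: x); last by exists al; rewrite subrK.
  apply: center_sub_derived => t; rewrite vbrDl vbrNl vbrZl.
  rewrite (DE [c, t]) ?vbr_derived // (DE [x, t]) ?vbr_derived // e1 e2 de.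
  by rewrite scalerDr !scalerA subrr.
(* Shifting [y] and [w] by these multiples of [x] keeps [[x, y]] and [[x, w]] and cancels
   [[y, w]]. *)
pose a : K := p1 [y, w]; pose b : K := p2 [y, w].
have ywE : [y, w] = a *: v + b *: v' by apply: DE; apply: vbr_derived.
have xx : [x, x] = 0 by apply: vbr_even; apply: all_even.
have xy' : [x, y - b *: x] = v by rewrite vbrDr vbrNr vbrZr xx scaler0 subr0.
have xw' : [x, w + a *: x] = v' by rewrite vbrDr vbrZr xx scaler0 addr0.
exists x, (y - b *: x), (w + a *: x); rewrite xy' xw'; split=> // [|u].
  rewrite vbrDr vbrZr vbrDl vbrNl vbrZl -/v' ywE.
  rewrite [ [y - _, x] ]vbrC xy' scalerN addrK.
  by rewrite subrr.
have xuE := DE _ (vbr_derived A x u).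
set r : K := p1 _ in xuE; set s : K := p2 _ in xuE.
(* Subtracting the combination of the shifted [y] and [w] that has the same bracket with [x] moves
   [u] into the centralizer of [x]. *)
have [t tD [a' uE]] : exists2 t, t \in D & exists a', u - r *: (y - b *: x) - s *: (w + a *: x) = t + a' *: x.
  apply: span; rewrite !vbrDr !vbrNr ![ [x, _ *: _] ]vbrZr xy' xw' xuE.
  by rewrite addrAC addrK subrr.
exists a', r, s, (p1 t : K), (p2 t : K).
rewrite -addrA -(DE t tD) -[LHS](subrK (r *: (y - b *: x))).
rewrite -[in LHS](subrK (s *: (w + a *: x)) (u - _)) uE.
by rewrite addrAC [t + _]addrC [X in X + _ = _]addrAC [LHS]addrAC.
Qed.

End TwoDimensionalDerived.

End Bounds.

(** * The Schur multiplier through cocycles *)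

Section Extension.
Variables (K : numFieldType) (V : vectType K) (A : vectSuper V).
Variable f : 'Hom(V, 'Hom(V, K^o)).
Hypotheses (skf : skew_form A f) (cof : cocycle A f).
Local Notation P := (vpar A).
Local Notation "[ x , y ]" := (vbr A x y) (at level 0).

(* The component of f of parity c, for which the extension has a centre of
   parity c. *)
Definition fcomponent (c : bool) (x y : V) : K :=
  fval f (vpart A false x) (vpart A c y) + fval f (vpart A true x) (vpart A (~~ c) y).

Lemma fcomponentDl c x y z : fcomponent c (x + y) z = fcomponent c x z + fcomponent c y z.
Proof. by rewrite /fcomponent !linearD /= !fvalDl addrACA. Qed.
Lemma fcomponentDr c x y z : fcomponent c z (x + y) = fcomponent c z x + fcomponent c z y.
Proof. by rewrite /fcomponent !linearD /= !fvalDr addrACA. Qed.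
Lemma fcomponentZl c a x z : fcomponent c (a *: x) z = a * fcomponent c x z.
Proof. by rewrite /fcomponent !linearZ /= !fvalZl mulrDr. Qed.
Lemma fcomponentZr c a x z : fcomponent c z (a *: x) = a * fcomponent c z x.
Proof. by rewrite /fcomponent !linearZ /= !fvalZr mulrDr. Qed.

Lemma fcomponentE c a b x y : x \in P a -> y \in P b ->
  fcomponent c x y = if a (+) b == c then fval f x y else 0.
Proof.
move=> hx hy; rewrite /fcomponent; case: a hx => hx; case: b hy => hy; case: c => /=;
  rewrite ?(vpart_id hx) ?(vpart_id hy) ?(vpart_other hx) ?(vpart_other hy);
  by rewrite ?fval0l ?fval0r ?addr0 ?add0r.
Qed.

Lemma fcomponent_sum x y : fcomponent false x y + fcomponent true x y = fval f x y.
Proof.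
rewrite /fcomponent [in RHS](vpartE A x) [in RHS](vpartE A y) !fvalDl !fvalDr /=; ring.
Qed.

(** The added centre has dimension (1|1), one coordinate for each component of [f], so that a single
    extension serves inhomogeneous cocycles. *)
Let W : lmodType K := (V * (K^o * K^o))%type.
Let cmp (b : bool) : set W :=
  [set u | u.1 \in P b /\ (if b then u.2.1 else u.2.2) = 0].
Let brk (u v : W) : W :=
  ([u.1, v.1], (fcomponent false u.1 v.1, fcomponent true u.1 v.1)).

Lemma ext_subspace b : subspace (cmp b).
Proof.
split=> [|a x y [hx x0] [hy y0]]; first by split; [apply: mem0v | case: b].
split=> /=; first by rewrite memvD ?memvZ.
by case: b {hx hy} x0 y0 => /= -> ->; rewrite scaler0 addr0.
Qed.

Lemma ext_span (x : W) : exists x0 x1, cmp false x0 /\ cmp true x1 /\ x = x0 + x1.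
Proof.
exists (vpart A false x.1, (x.2.1, 0)), (vpart A true x.1, (0, x.2.2)).
split; first by split=> //=; apply: vpart_mem.
split; first by split=> //=; apply: vpart_mem.
case: x => u [s t] /=; rewrite {1}(vpartE A u).
by congr (_, (_, _)); rewrite ?addr0 ?add0r.
Qed.

Lemma ext_direct (x : W) : cmp false x -> cmp true x -> x = 0.
Proof.
case: x => u [s t] [/= u0 ->] [/= u1 ->]; congr (_, _).
exact: vpar_direct u0 u1.
Qed.

Lemma ext_linearl (y : W) : linear (brk^~ y).
Proof.
move=> a u v; congr (_, (_, _)) => /=; first by rewrite vbrDl vbrZl.
  by rewrite fcomponentDl fcomponentZl.
by rewrite fcomponentDl fcomponentZl.
Qed.

Lemma ext_linearr (x : W) : linear (brk x).
Proof.
move=> a u v; congr (_, (_, _)) => /=; first by rewrite vbrDr vbrZr.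
  by rewrite fcomponentDr fcomponentZr.
by rewrite fcomponentDr fcomponentZr.
Qed.

Lemma ext_comp a b (x y : W) : cmp a x -> cmp b y -> cmp (a (+) b) (brk x y).
Proof.
move=> [hx _] [hy _]; split=> /=; first exact: vbr_par.
by case: a hx => hx; case: b hy => hy /=; rewrite (fcomponentE _ hx hy).
Qed.

Lemma fcomponent_skew c a b x y : x \in P a -> y \in P b ->
  fcomponent c x y = - ((-1) ^+ (a && b) * fcomponent c y x).
Proof.
move=> hx hy; rewrite (fcomponentE c hx hy) (fcomponentE c hy hx) [b (+) a]addbC.
by case: eqP => _; rewrite ?mulr0 ?oppr0 // (skf hx hy).
Qed.

Lemma fcomponent_jacobi c a b x y z : x \in P a -> y \in P b ->
  fcomponent c x [y, z] =
    fcomponent c [x, y] z + (-1) ^+ (a && b) * fcomponent c y [x, z].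
Proof.
move=> hx hy; move: z; apply: (homogeneous_ind (A := A)) => [u v hu hv|d z hz].
  by rewrite !vbrDr !fcomponentDr hu hv; ring.
rewrite (fcomponentE c hx (vbr_par hy hz)) (fcomponentE c (vbr_par hx hy) hz).
rewrite (fcomponentE c hy (vbr_par hx hz)) -addbA [b (+) (a (+) d)]addbCA.
by case: eqP => _; rewrite ?mulr0 ?addr0 // (cof z hx hy).
Qed.

Lemma ext_skew a b (x y : W) : cmp a x -> cmp b y ->
  brk x y = - ((-1) ^+ (a && b) *: brk y x).
Proof.
move=> [hx _] [hy _]; congr (_, (_, _)) => /=; first exact: vbr_skew.
  exact: fcomponent_skew.
exact: fcomponent_skew.
Qed.

Lemma ext_jacobi a b (x y z : W) : cmp a x -> cmp b y ->
  brk x (brk y z) = brk (brk x y) z + (-1) ^+ (a && b) *: brk y (brk x z).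
Proof.
move=> [hx _] [hy _]; congr (_, (_, _)) => /=; first exact: vbr_jacobi.
  exact: fcomponent_jacobi.
exact: fcomponent_jacobi.
Qed.

Definition central_extension : lieSuper K :=
  LieSuper ext_subspace ext_span ext_direct ext_linearl ext_linearr ext_comp
    ext_skew ext_jacobi.

(** Freeness lifts [pi] to the extension, and its uniqueness clause identifies the first coordinate
    of the lift with [pi]. The functional [lam] is the sum of the two central coordinates. *)
Lemma cocycle_lift (F : lieSuper K) (pi : F -> super_of A) : free_presentation pi ->
  exists lam : F -> K^o, linear lam /\
    forall x y, lam (bracket F x y) = fval f (pi x) (pi y).
Proof.
move=> [[X [p [i [hi hfree]]]] [[pil [pic pib]] _]].
pose g x : central_extension := (pi (i x), 0).
have hg x : component central_extension (p x) (g x).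
  by split; [apply: pic; apply: hi | case: (p x)].
have [phi [[[phil [phic phib]] phig] _]] := hfree _ g hg.
have hpi x : component (super_of A) (p x) (pi (i x)) by apply: pic; apply: hi.
have [psi [_ psiu]] := hfree _ (fun x => pi (i x)) hpi.
have fstE x : (phi x).1 = pi x.
  have e1 : psi = pi by apply: psiu.
  have e2 : psi = (fun x => (phi x).1).
    apply: psiu; split=> [|y]; last by rewrite phig.
    split; first by move=> a u v; rewrite phil.
    by split=> [b u /phic []|u v] //; rewrite phib.
  by have := congr1 (fun h => h x) e1; rewrite e2.
exists (fun x => (phi x).2.1 + (phi x).2.2); split=> [a u v|u v].
  by rewrite phil /= scalerDr addrACA.
by rewrite phib /= !fstE fcomponent_sum.
Qed.

End Extension.

Section Multiplier.
Variables (K : numFieldType) (V : vectType K) (A : vectSuper V).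
Variables (F : lieSuper K) (pi : F -> super_of A).
Hypothesis hF : free_presentation pi.
Local Notation P := (vpar A).
Local Notation "[ x , y ]" := (vbr A x y) (at level 0).
Local Notation "<[ x , y ]>" := (bracket F x y) (at level 0).

Let FF : set F := bracket_space setT setT.
Let R := kernel pi.
Let FR : set F := bracket_space setT R.

Let sFF : subspace FF. Proof. exact: linear_span_subspace. Qed.
Let sFR : subspace FR. Proof. exact: linear_span_subspace. Qed.
Let pil : linear (pi : F -> V). Proof. by case: hF => _ [[]]. Qed.
Let pib x y : pi <[x, y]> = [pi x, pi y].
Proof. by case: hF => _ [[_ [_ h]] _]; apply: h. Qed.
Let pih : is_hom pi. Proof. by case: hF => _ []. Qed.

Let sR : subspace R.
Proof.
split=> [|a x y hx hy]; first exact: (lin0 pil).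
by rewrite /R /kernel /= pil hx hy scaler0 addr0.
Qed.

Let FFbr x y : FF <[x, y]>.
Proof. by apply: mem_linear_span; exists x => //; exists y. Qed.

Let FRbr x r : R r -> FR <[x, r]>.
Proof. by move=> hr; apply: mem_linear_span; exists x => //; exists r. Qed.

Let R_hpart b r : R r -> R (hpart b r).
Proof.
move=> hr; rewrite /R /kernel /= (hpart_hom _ _ pih).
by have -> : pi r = 0 := hr; apply: (lin0 (hpart_linear (L := super_of A) b)).
Qed.

Let FRbrl r x : R r -> FR <[r, x]>.
Proof.
move=> hr; rewrite bracket_hparts.
have h a b : FR <[hpart a r, hpart b x]>.
  rewrite (bracket_skew (hpart_mem a r) (hpart_mem b x)) -scaleN1r scalerA.
  by apply: (subspaceZ _ sFR); apply: FRbr; apply: R_hpart.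
by do 3 apply: (subspaceD sFR) => //.
Qed.

Let FR_FF : FR `<=` FF.
Proof. by apply: linear_span_min => // _ [x _ [y _ <-]]. Qed.

Let FR_R : FR `<=` R.
Proof.
apply: linear_span_min => // _ [x _ [y hy <-]]; rewrite /R /kernel /= pib.
by have -> : pi y = 0 := hy; rewrite vbr0r.
Qed.

Let section_exists : exists s : V -> F, forall x, pi (s x) = x.
Proof.
case: hF => _ [_ h]; have /choice [s hs] : forall x : V, exists y, pi y = x := h.
by exists s.
Qed.

Let bracket_mod_kernel u v u' v' : pi u = pi u' -> pi v = pi v' ->
  FR (<[u, v]> - <[u', v']>).
Proof.
move=> hu hv.
have -> : <[u, v]> - <[u', v']> = <[u - u', v]> + <[u', v - v']>.
  rewrite (linB (bracket_linearl _)) (linB (bracket_linearr _)).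
  by rewrite addrA subrK.
have hR x y : pi x = pi y -> R (x - y).
  by move=> xy; rewrite /R /kernel /= (linB pil) xy subrr.
by apply: (subspaceD sFR); [apply: FRbrl|apply: FRbr]; apply: hR.
Qed.

Let derived_lift u : u \in derived A -> exists2 w, FF w & pi w = u.
Proof.
have [s hs] := section_exists.
apply: (@derived_ind _ _ A (fun u => exists2 w, FF w & pi w = u)) => [|x y].
  split=> [|a x y [w hw <-] [w' hw' <-]].
    by exists 0; [exact: (subspace0 sFF) | apply: (lin0 pil)].
  by exists (a *: w + w'); [apply: sFF.2 | rewrite pil].
by exists <[s x, s y]>; rewrite // pib !hs.
Qed.

Let pi_derived w : FF w -> pi w \in derived A.
Proof.
apply: (linear_span_min (B := [set w | pi w \in derived A])).
  exact: (subspace_preim pil (vspace_subspace (derived A))).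
by move=> _ [x _ [y _ <-]] /=; rewrite pib vbr_derived.
Qed.

(* The cocycles are the dual of [F, F] / [F, R]: a cocycle f corresponds to the
   functional sending [u, v] to f (pi u) (pi v), which exists because pi lifts
   to the central extension defined by f. *)
Lemma quot_dim_cocycles q : quot_dim FF FR q -> \dim (cocycles A 0%VS) = q.
Proof.
move=> [e [he hu]]; have [s hs] := section_exists.
(* Coordinates of classes modulo [FR]. Outside [FF] the value is arbitrary, and [co] is evaluated
   only on [FF]. *)
have /choice [co hco] : forall x, exists c : 'rV[K]_q,
    FF x -> FR (x - \sum_i c ord0 i *: e i).
  move=> x; have [/hu [c [hc _]]|h] := pselect (FF x); first by exists c.
  by exists 0.
have co_uniq x (c : 'rV[K]_q) : FF x -> FR (x - \sum_i c ord0 i *: e i) -> co x = c.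
  by move=> hx hc; have [c' [_ h]] := hu x hx; rewrite -(h c hc) -(h (co x)) //; apply: hco.
have co_lin a x y : FF x -> FF y -> co (a *: x + y) = a *: co x + co y.
  move=> hx hy; apply: co_uniq; first exact: sFF.2.
  have -> : \sum_i (a *: co x + co y) ord0 i *: e i =
     a *: (\sum_i co x ord0 i *: e i) + \sum_i co y ord0 i *: e i.
    rewrite scaler_sumr -big_split /=; apply: eq_bigr => i _.
    by rewrite !mxE scalerDl scalerA.
  rewrite opprD addrACA -scalerBr; apply: sFR.2; exact: hco.
have co_FR x : FR x -> co x = 0.
  move=> hx; apply: co_uniq; first exact: FR_FF.
  by rewrite big1 ?subr0 // => i _; rewrite mxE scale0r.
have co_mod u v u' v' : pi u = pi u' -> pi v = pi v' -> co <[u, v]> = co <[u', v']>.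
  move=> hu' hv'; have := co_FR _ (bracket_mod_kernel hu' hv').
  rewrite addrC -scaleN1r co_lin // scaleN1r addrC => /eqP.
  by rewrite subr_eq0 => /eqP.
(* The form of the functional with values [a] on the classes of the [e i]; by [co_mod] it does not
   depend on the section [s]. *)
pose bb (a : 'rV[K]_q) x y : K := \sum_i a ord0 i * co <[s x, s y]> ord0 i.
have bbE a u v : bb a (pi u) (pi v) = \sum_i a ord0 i * co <[u, v]> ord0 i.
  by rewrite /bb (co_mod (s (pi u)) (s (pi v)) u v) ?hs.
have bbl a y : scalar (bb a ^~ y).
  move=> c x x'.
  have h : co <[s (c *: x + x'), s y]> = c *: co <[s x, s y]> + co <[s x', s y]>.
    by rewrite -co_lin // -bracket_linearl; apply: co_mod; rewrite ?pil ?hs.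
  rewrite /bb h mulr_sumr -big_split /=; apply: eq_bigr => i _; rewrite !mxE; ring.
have bbr a x : scalar (bb a x).
  move=> c y y'.
  have h : co <[s x, s (c *: y + y')]> = c *: co <[s x, s y]> + co <[s x, s y']>.
    by rewrite -co_lin // -bracket_linearr; apply: co_mod; rewrite ?pil ?hs.
  rewrite /bb h mulr_sumr -big_split /=; apply: eq_bigr => i _; rewrite !mxE; ring.
have /choice [S0 hS0] : forall a, exists g : 'Hom(V, 'Hom(V, K^o)),
    forall x y, fval g x y = bb a x y.
  by move=> a; apply: bilinear_exists.
have [S hS] : exists S : 'Hom('rV[K]_q, 'Hom(V, 'Hom(V, K^o))), forall a, S a = S0 a.
  apply: lfun_exists => c a a'; apply/lfunP => x; apply/lfunP => y.
  rewrite !add_lfunE !scale_lfunE.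
  have E b : S0 b x y = bb b x y := hS0 b x y.
  rewrite !E; suff -> : bb (c *: a + a') x y = c * bb a x y + bb a' x y by [].
  rewrite /bb mulr_sumr -big_split /=.
  apply: eq_bigr => i _; rewrite !mxE; ring.
have SE a u v : fval (S a) (pi u) (pi v) = \sum_i a ord0 i * co <[u, v]> ord0 i.
  by rewrite hS hS0 bbE.
have hlift b x : x \in P b -> exists2 u, component F b u & pi u = x.
  move=> hx; exists (hpart b (s x)); first exact: hpart_mem.
  by rewrite (hpart_hom _ _ pih) hs; apply: hpart_id.
have Ssub : (limg S = cocycles A 0)%VS.
  apply/vspaceP => f; apply/idP/idP.
    move=> /memv_imgP [a _ ->]; apply/cocyclesP; split.
    - move=> b c _ _ /hlift [u hu' <-] /hlift [v hv <-]; rewrite !SE.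
      rewrite (bracket_skew hu' hv) -scaleN1r scalerA.
      rewrite -[_ *: _]addr0 co_lin ?(co_FR 0 (subspace0 sFR)) //; last exact: (subspace0 sFF).
      rewrite mulr_sumr -sumrN; apply: eq_bigr => i _; rewrite !mxE; ring.
    - move=> b c _ _ z /hlift [u hu' <-] /hlift [v hv <-].
      rewrite -(hs z) -!pib !SE (bracket_jacobi _ hu' hv) addrC co_lin //.
      rewrite mulr_sumr -big_split /=; apply: eq_bigr => i _; rewrite !mxE; ring.
    - by move=> x y; rewrite memv0 => /eqP ->; rewrite fval0l.
  (* Surjectivity: since [lam] vanishes on [FR], its values on the representatives [e i] determine
     the cocycle. *)
  move=> /cocyclesP [sf cf _]; have [lam [laml lamb]] := cocycle_lift sf cf hF.
  have lamFR x : FR x -> lam x = 0.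
    apply: (linear_span_min (B := [set x | lam x = 0])).
      split=> [|a u v hu' hv] /=; first exact: (lin0 laml).
      by rewrite laml hu' hv scaler0 addr0.
    by move=> _ [u _ [v hv <-]] /=; rewrite lamb (hv : pi v = 0) fval0r.
  apply/memv_imgP; exists (\row_i (lam (e i) : K)); first exact: memvf.
  apply/lfunP => x; apply/lfunP => y; rewrite -(hs x) -(hs y).
  rewrite -[RHS]/(fval _ _ _) SE -[LHS]/(fval _ _ _) -lamb.
  have /lamFR := hco _ (FFbr (s x) (s y)).
  rewrite (linB laml) linear_comb // => /eqP; rewrite subr_eq0 => /eqP ->.
  by apply: eq_bigr => i _; rewrite mxE mulrC.
(* A functional that kills all brackets is zero because they span [FF]. *)
have Sinj : (lker S = 0)%VS.
  apply/eqP; rewrite -subv0; apply/subvP => a; rewrite memv_ker memv0 => /eqP Sa.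
  have h w : FF w -> FF w /\ \sum_i a ord0 i * co w ord0 i = 0.
    apply: (linear_span_min (B := [set w | FF w /\ \sum_i a ord0 i * co w ord0 i = 0])).
      split=> [|c u v [hu' su] [hv sv]] /=.
        split; first exact: (subspace0 sFF).
        by rewrite co_FR ?big1 // => [i _|]; rewrite ?mxE ?mulr0 //; exact: (subspace0 sFR).
      split; first exact: sFF.2.
      transitivity (c * (\sum_i a ord0 i * co u ord0 i) + \sum_i a ord0 i * co v ord0 i).
        rewrite mulr_sumr -big_split /=; apply: eq_bigr => i _.
        by rewrite co_lin // !mxE; ring.
      by rewrite su sv mulr0 addr0.
    by move=> _ [u _ [v _ <-]] /=; split=> //; rewrite -SE Sa /fval !zero_lfunE.
  apply/eqP/rowP => j; rewrite mxE; have [_] := h (e j) (he j).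
  have -> : co (e j) = delta_mx ord0 j.
    apply: co_uniq => //; rewrite (bigD1 j) //= mxE !eqxx scale1r big1 ?addr0 ?subrr.
      exact: (subspace0 sFR).
    by move=> i /negbTE ij; rewrite mxE ij andbF scale0r.
  rewrite (bigD1 j) //= mxE !eqxx mulr1 big1 ?addr0 // => i /negbTE ij.
  by rewrite mxE ij andbF mulr0.
rewrite -Ssub limg_dim_eq ?dimvf ?Sinj ?capv0 //.
by rewrite /dim /= mul1n.
Qed.

(** The map [pi] induces an isomorphism from the quotient of [FF] by its intersection with [R] onto
    [derived A]; lifts of a basis of the latter complete the given family. *)
Lemma quot_dim_add_derived d : quot_dim (FF `&` R) FR d ->
  quot_dim FF FR (d + \dim (derived A)).
Proof.
move=> [e [he hu]]; pose b := vbasis (derived A).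
have bD (j : 'I_(\dim (derived A))) : b`_j \in derived A.
  by apply: vbasis_mem; rewrite mem_nth ?size_tuple.
have /choice [u hu'] : forall j : 'I_(\dim (derived A)), exists w, FF w /\ pi w = b`_j.
  by move=> j; have [w ? ?] := derived_lift (bD j); exists w.
pose e' (i : 'I_(d + \dim (derived A))) := match split i with inl i => e i | inr j => u j end.
have sumE (c : 'rV[K]_(d + \dim (derived A))) : \sum_i c ord0 i *: e' i =
    \sum_i lsubmx c ord0 i *: e i + \sum_j rsubmx c ord0 j *: u j.
  rewrite big_split_ord /=; congr (_ + _); apply: eq_bigr => i _; rewrite mxE /e'.
    by rewrite (unsplitK (inl i)).
  by rewrite (unsplitK (inr i)).
exists e'; split=> [i|x hx].
  by rewrite /e'; case: (split i) => j; [case: (he j) | case: (hu' j)].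
pose c2 := \row_j coord b j (pi x).
have piu (c : 'rV[K]_(\dim (derived A))) : pi (\sum_j c ord0 j *: u j) = \sum_j c ord0 j *: b`_j.
  by rewrite linear_comb //; apply: eq_bigr => j _; rewrite (hu' j).2.
have c2E : pi (\sum_j c2 ord0 j *: u j) = pi x.
  rewrite piu [RHS](coord_vbasis (pi_derived hx)).
  by apply: eq_bigr => j _; rewrite mxE.
have hx' : (FF `&` R) (x - \sum_j c2 ord0 j *: u j).
  split; last by rewrite /R /kernel /= (linB pil) c2E subrr.
  by apply: (subspaceB sFF) => //; apply: (subspace_lincomb _ sFF) => j; case: (hu' j).
have [c1 [h1 h1u]] := hu _ hx'.
exists (row_mx c1 c2); split=> [|c].
  by rewrite sumE row_mxKl row_mxKr opprD addrA addrAC.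
rewrite sumE => hc; rewrite -[c]hsubmxK.
have c2c : rsubmx c = c2.
  have hs0 : pi (\sum_i lsubmx c ord0 i *: e i) = 0.
    rewrite linear_comb // big1 // => i _; have [_ h] := he i.
    by rewrite (h : pi (e i) = 0) scaler0.
  have := FR_R hc; rewrite /R /kernel /= (linB pil) (linD pil) hs0 add0r piu => /eqP.
  rewrite subr_eq0 => /eqP h; apply/rowP => j; rewrite mxE [c2 _ _]mxE h.
  by rewrite -[c _ _](mxE matrix_key (fun i j => c i (rshift _ j))) coord_sum_free ?mxE // (basis_free (vbasisP _)).
rewrite c2c; congr row_mx; apply: h1u.
by move: hc; rewrite c2c opprD addrA addrAC.
Qed.

(** Modulo [FR] a bracket depends only on the images of its arguments under [pi], so finitely many
    brackets of lifted basis vectors span [FF] modulo [FR]. *)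
Lemma presentation_multiplier_dim_exists : exists d, presentation_multiplier_dim pi d.
Proof.
have [s hs] := section_exists.
pose n := \dim {:V}; pose b := vbasis {:V}.
pose g (k : 'I_#|{: 'I_n * 'I_n}|) := <[s b`_(enum_val k).1, s b`_(enum_val k).2]>.
pose G : set F := [set w | exists c : 'rV[K]__, FR (w - \sum_i c ord0 i *: g i)].
have sG : subspace G.
  split=> [|a x y [c hc] [c' hc']].
    by exists 0; rewrite big1 ?subr0 => [|i _]; [exact: (subspace0 sFR)|rewrite mxE scale0r].
  exists (a *: c + c'); have -> : \sum_i (a *: c + c') ord0 i *: g i =
     a *: (\sum_i c ord0 i *: g i) + \sum_i c' ord0 i *: g i.
    rewrite scaler_sumr -big_split /=; apply: eq_bigr => i _.
    by rewrite !mxE scalerDl scalerA.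
  by rewrite opprD addrACA -scalerBr; apply: sFR.2.
have FRG x : FR x -> G x.
  by move=> hx; exists 0; rewrite big1 ?subr0 // => i _; rewrite mxE scale0r.
have Gg (i j : 'I_n) : G <[s b`_i, s b`_j]>.
  exists (delta_mx ord0 (enum_rank (i, j))).
  rewrite (bigD1 (enum_rank (i, j))) //= mxE !eqxx scale1r /g enum_rankK /=.
  rewrite big1 ?addr0 ?subrr; first exact: (subspace0 sFR).
  by move=> k /negbTE hk; rewrite mxE hk andbF scale0r.
have piE u : pi u = pi (\sum_i coord b i (pi u) *: s b`_i).
  have := linear_comb (\row_i coord b i (pi u)) (fun i : 'I_n => s b`_i) pil.
  under eq_bigr do rewrite mxE; move=> ->; rewrite [LHS](coord_vbasis (memvf _)).
  by apply: eq_bigr => i _; rewrite mxE hs.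
apply: (@quot_dim_exists _ _ _ _ _ g); first exact: subspaceI.
- exact: sFR.
- by move=> x hx; split; [apply: FR_FF | apply: FR_R].
move=> x [hx _]; suff : G x by [].
move: x hx; apply: linear_span_min => // _ [u _ [v _ <-]].
rewrite -[<[u, v]>](subrK <[\sum_i coord b i (pi u) *: s b`_i, \sum_i coord b i (pi v) *: s b`_i]>).
apply: (subspaceD sG).
  by apply: FRG; apply: bracket_mod_kernel; apply: piE.
have sl y : subspace (fun x => G <[x, y]>) := subspace_preim (bracket_linearl y) sG.
have sr x : subspace (fun y => G <[x, y]>) := subspace_preim (bracket_linearr x) sG.
apply: (subspace_sum _ (sl _)) => i; apply: (subspaceZ _ (sl _)).
apply: (subspace_sum _ (sr _)) => j; apply: (subspaceZ _ (sr _)).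
exact: Gg.
Qed.

Lemma presentation_multiplier_dimE d : presentation_multiplier_dim pi d ->
  (d + \dim (derived A) = \dim (cocycles A 0%VS))%N.
Proof. by move=> /quot_dim_add_derived/quot_dim_cocycles. Qed.

End Multiplier.

Theorem multiplier_dim_cocycles (K : numFieldType) (V : vectType K) (A : vectSuper V) :
  (multiplier_dim (super_of A) + \dim (derived A) = \dim (cocycles A 0%VS))%N.
Proof.
have [F [pi hF]] := free_presentation_exists (super_of A).
have [d hd] := presentation_multiplier_dim_exists hF.
(* The value chosen by [xget] may come from another presentation, for which the same formula holds;
   the existence of [d] rules out the default value. *)
rewrite /multiplier_dim; case: xgetP => [d' _ [F' [pi' [hF' hd']]]|/(_ d) []].
  exact: presentation_multiplier_dimE hd'.
by exists F, pi.
Qed.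

(** * Invariance under isomorphism *)

Section Isomorphisms.
Variable K : numFieldType.
Implicit Types L M : lieSuper K.

Lemma graded_inverse L M (f : L -> M) (g : M -> L) :
  linear f -> (forall a x, component L a x -> component M a (f x)) ->
  cancel f g -> cancel g f ->
  linear g /\ (forall a y, component M a y -> component L a (g y)).
Proof.
move=> fl fc fK gK; split=> [a x y|a y hy].
  by apply: (can_inj fK); rewrite fl !gK.
have h : hpart (~~ a) (g y) = 0.
  apply: (can_inj fK); rewrite (hpart_graded _ _ fl fc) gK (lin0 fl).
  exact: hpart_other.
have -> : g y = hpart a (g y).
  by rewrite [LHS]hpartE; case: a h {hy} => /= ->; rewrite ?addr0 ?add0r.
exact: hpart_mem.
Qed.

Lemma isomorphic_sym L M : isomorphic L M -> isomorphic M L.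
Proof.
move=> [f [[fl [fc fb]] [g fK gK]]]; have [gl gc] := graded_inverse fl fc fK gK.
exists g; split; last by exists f.
by split=> //; split=> // x y; apply: (can_inj fK); rewrite fb !gK.
Qed.

Lemma isomorphic_trans L M L' : isomorphic L M -> isomorphic M L' -> isomorphic L L'.
Proof.
move=> [f [[fl [fc fb]] fbij]] [g [[gl [gc gb]] gbij]].
exists (g \o f); split; last exact: bij_comp.
split; first by move=> a x y /=; rewrite fl gl.
by split=> [a x hx|x y] /=; [apply/gc/fc | rewrite fb gb].
Qed.

(** Composing a presentation with an isomorphism keeps its kernel, so both sides apply [xget] to the
    same set. *)
Lemma multiplier_dim_iso L M : isomorphic L M -> multiplier_dim L = multiplier_dim M.
Proof.
suff sub L1 L2 : isomorphic L1 L2 ->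
    [set d | exists (F : lieSuper K) (pi : F -> L1),
      free_presentation pi /\ presentation_multiplier_dim pi d] `<=`
    [set d | exists (F : lieSuper K) (pi : F -> L2),
      free_presentation pi /\ presentation_multiplier_dim pi d].
  by move=> h; congr xget; apply/seteqP; split; apply: sub => //; apply: isomorphic_sym.
move=> [f [[fl [fc fb]] [g fK gK]]] d [F [pi [[hF [[pil [pic pib]] surj]] hd]]].
exists F, (f \o pi); split.
  split=> //; split.
    split; first by move=> a x y /=; rewrite pil fl.
    by split=> [a x hx|x y] /=; [apply/fc/pic | rewrite pib fb].
  by move=> y; have [x hx] := surj (g y); exists x; rewrite /= hx gK.
suff kerE : kernel (f \o pi) = kernel pi by rewrite /presentation_multiplier_dim kerE.
apply/seteqP; split=> x /=; rewrite /kernel /= => hx; last by rewrite hx (lin0 fl).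
by apply: (can_inj fK); rewrite hx (lin0 fl).
Qed.

Lemma nilpotent_iso L M : isomorphic L M -> lie_nilpotent L -> lie_nilpotent M.
Proof.
move=> [f [[fl [fc fb]] [g fK gK]]] [k hk]; exists k.
have sub j : central_series M j `<=` f @` central_series L j.
  elim: j => [y _|j IHj]; first by exists (g y).
  apply: linear_span_min => [|_ [_ /IHj [x hx <-] [y _ <-]]].
    by apply: subspace_image => //; apply: linear_span_subspace.
  exists (bracket L x (g y)); last by rewrite fb gK.
  by apply: mem_linear_span; exists x => //; exists (g y).
apply/seteqP; split=> [y /sub [x]|_ ->].
  by rewrite hk => -> <-; apply: (lin0 fl).
case: (k) => [//|j]; exact: (subspace0 (linear_span_subspace _)).
Qed.

Lemma superdim_iso L M m n : isomorphic L M -> superdim L m n -> superdim M m n.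
Proof.
move=> [f [[fl [fc fb]] [g fK gK]]]; have [gl gc] := graded_inverse fl fc fK gK.
have h b d : quot_dim (component L b) [set 0] d -> quot_dim (component M b) [set 0] d.
  move=> [e [he hu]]; exists (fun i => f (e i)); split=> [i|y hy]; first exact: fc.
  have [c [hc cu]] := hu _ (gc _ _ hy).
  have tr (c' : 'rV[K]_d) : y - \sum_i c' ord0 i *: f (e i) = f (g y - \sum_i c' ord0 i *: e i).
    by rewrite (linB fl) gK (linear_comb c' e fl).
  exists c; split=> [|c' hc'].
    by rewrite /= tr (hc : g y - _ = 0) (lin0 fl).
  apply: cu; apply: (can_inj fK); rewrite -tr (lin0 fl); exact: hc'.
by move=> [h0 h1]; split; apply: h.
Qed.

(** Here [abelian_super K m n] stands for the standard graded vector space; the coordinates serve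
    both the abelian case and the transport of an arbitrary bracket. *)
Lemma superdim_coordinates L m n : superdim L m n ->
  exists (g : abelian_super K m n -> L),
    [/\ linear g, forall b u, component (abelian_super K m n) b u -> component L b (g u)
      & bijective g].
Proof.
move=> [[e0 [he0 hu0]] [e1 [he1 hu1]]].
pose g0 (c : 'rV[K]_m) := \sum_i c ord0 i *: e0 i.
pose g1 (c : 'rV[K]_n) := \sum_i c ord0 i *: e1 i.
have lcomb d (e : 'I_d -> L) : linear (fun c : 'rV[K]_d => \sum_i c ord0 i *: e i).
  move=> a x y; rewrite scaler_sumr -big_split /=; apply: eq_bigr => i _.
  by rewrite !mxE scalerDl scalerA.
have g0l : linear g0 := lcomb _ e0; have g1l : linear g1 := lcomb _ e1.
have g0c c : component L false (g0 c) by apply: subspace_lincomb => //; apply: component_subspace.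
have g1c c : component L true (g1 c) by apply: subspace_lincomb => //; apply: component_subspace.
have g0i c : g0 c = 0 -> c = 0.
  move=> gc; have [c' [_ hc']] := hu0 0 (subspace0 (component_subspace L false)).
  have <- : c' = c by apply: hc'; rewrite /= [\sum_i _](gc : _ = 0) subr0.
  by apply: hc'; rewrite /= [\sum_i _](lin0 g0l : _ = 0) subr0.
have g1i c : g1 c = 0 -> c = 0.
  move=> gc; have [c' [_ hc']] := hu1 0 (subspace0 (component_subspace L true)).
  have <- : c' = c by apply: hc'; rewrite /= [\sum_i _](gc : _ = 0) subr0.
  by apply: hc'; rewrite /= [\sum_i _](lin0 g1l : _ = 0) subr0.
pose g (u : abelian_super K m n) : L := g0 u.1 + g1 u.2.
have gl : linear g.
  by move=> a u v; rewrite /g /= g0l g1l scalerDr addrACA.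
have ginj : injective g.
  move=> u v /eqP; rewrite -subr_eq0 -(linB gl) => /eqP h.
  have gE : g (u - v) = g0 (u - v).1 + g1 (u - v).2 by [].
  have := hpart_uniq (b := false) (g0c _) (g1c _) gE.
  have := hpart_uniq (b := true) (g1c _) (g0c _) (etrans gE (addrC _ _)).
  rewrite h !(lin0 (hpart_linear _)) => /esym/g1i /= /eqP h1 /esym/g0i /= /eqP h0.
  move: h0 h1; rewrite !subr_eq0; case: (u) (v) => [u0 u1] [v0 v1] /=.
  by move=> /eqP -> /eqP ->.
have gsurj x : exists u, g u = x.
  have [c0 [h0 _]] := hu0 _ (hpart_mem false x).
  have [c1 [h1 _]] := hu1 _ (hpart_mem true x).
  exists (c0, c1); rewrite /g /= [RHS]hpartE; congr (_ + _); apply/esym/eqP.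
    by rewrite -subr_eq0; apply/eqP.
  by rewrite -subr_eq0; apply/eqP.
have /choice [h hh] := gsurj.
exists g; split=> //; last by exists h => // u; apply: ginj.
by case=> u /= hu; rewrite /g hu ?(lin0 g0l) ?(lin0 g1l) ?add0r ?addr0.
Qed.

Lemma isomorphic_abelian L m n : superdim L m n -> (forall x y, bracket L x y = 0) ->
  isomorphic L (abelian_super K m n).
Proof.
move=> hdim h0; have [g [gl gc gbij]] := superdim_coordinates hdim.
apply: isomorphic_sym; exists g; split=> //; split=> //; split=> // x y.
by rewrite h0; apply: (lin0 gl).
Qed.

(** Dimensions of subspaces require a [vectType], so the bracket is transported to pairs of row
    vectors. *)
Lemma superdim_model L m n : superdim L m n ->
  exists (V : vectType K) (A : vectSuper V), isomorphic L (super_of A).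
Proof.
move=> hdim; have [g [gl gc [h gK hK]]] := superdim_coordinates hdim.
have [hl hc] := graded_inverse gl gc gK hK.
pose V : vectType K := ('rV[K]_m * 'rV[K]_n)%type; exists V.
have {}gK : cancel (g : V -> L) h := gK.
have {}gl : linear (g : V -> L) := gl.
have {}hl : linear (h : L -> V) := hl.
pose par b : {vspace V} := vspace_of (component (abelian_super K m n) b : set V).
have parP b (u : V) : u \in par b <-> component (abelian_super K m n) b u.
  by rewrite -(mem_vspace_of u (component_subspace (abelian_super K m n) b)).
pose br (u v : V) : V := h (bracket L (g u) (g v)).
have span : (par false + par true = fullv)%VS.
  apply/eqP; rewrite eqEsubv subvf /=; apply/subvP => u _.
  have [u0 [u1 [h0 [h1 ->]]]] := component_span (u : abelian_super K m n).
  by apply: memv_add; apply/parP.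
have cap : (par false :&: par true = 0)%VS.
  apply/eqP; rewrite -subv0; apply/subvP => u /memv_capP [/parP h0 /parP h1].
  by rewrite memv0; apply/eqP/(component_direct (l := abelian_super K m n)).
have linl y : linear (br^~ y).
  by move=> a u v; rewrite /br gl (bracket_linearl _ a) hl.
have linr x : linear (br x).
  by move=> a u v; rewrite /br gl (bracket_linearr _ a) hl.
have brp a b x y : x \in par a -> y \in par b -> br x y \in par (a (+) b).
  move=> /parP/gc hx /parP/gc hy; apply/parP/hc; exact: bracket_component.
have skew a b x y : x \in par a -> y \in par b ->
    br x y = - ((-1) ^+ (a && b) *: br y x).
  move=> /parP/gc hx /parP/gc hy.
  by rewrite /br (bracket_skew hx hy) (linN hl) (linZ hl).
have jacobi a b x y z : x \in par a -> y \in par b ->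
    br x (br y z) = br (br x y) z + (-1) ^+ (a && b) *: br y (br x z).
  move=> /parP/gc hx /parP/gc hy.
  by rewrite /br !hK (bracket_jacobi _ hx hy) (linD hl) (linZ hl).
exists (VectSuper span cap linl linr brp skew jacobi); exists h; split; last by exists g.
split=> //; split=> [a x /hc hx|x y]; first exact/parP.
by rewrite /= /br !hK.
Qed.

Lemma superdim_super_of (V : vectType K) (A : vectSuper V) m n :
  superdim (super_of A) m n -> \dim (vpar A false) = m /\ \dim (vpar A true) = n.
Proof. by move=> [h0 h1]; split; apply: quot_dim_vspace. Qed.

Lemma superdim_abelian m n : superdim (abelian_super K m n) m n.
Proof.
have sumE d (c : 'rV[K]_d) : \sum_i c ord0 i *: (delta_mx ord0 i : 'rV[K]_d) = c.
  exact: esym (row_sum_delta c).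
have pair1 d (c : 'rV[K]_d) : \sum_i c ord0 i *: ((delta_mx ord0 i, 0) : 'rV[K]_d * 'rV[K]_n) = (c, 0).
  rewrite -[in RHS](sumE _ c); apply: (big_ind2 (fun u v => u = (v, 0))) => // [x1 x2 y1 y2 -> ->|i _].
    by congr (_, _); rewrite addr0.
  by congr (_, _); rewrite scaler0.
have pair2 d (c : 'rV[K]_d) : \sum_i c ord0 i *: ((0, delta_mx ord0 i) : 'rV[K]_m * 'rV[K]_d) = (0, c).
  rewrite -[in RHS](sumE _ c); apply: (big_ind2 (fun u v => u = (0, v))) => // [x1 x2 y1 y2 -> ->|i _].
    by congr (_, _); rewrite addr0.
  by congr (_, _); rewrite scaler0.
split.
  exists (fun i => (delta_mx ord0 i, 0)); split=> // -[u0 u1] /= ->.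
  exists u0; split=> [|c] /=; first by rewrite pair1 subrr.
  by rewrite pair1 => -[] /eqP; rewrite subr_eq0 => /eqP ->.
exists (fun i => (0, delta_mx ord0 i)); split=> // -[u0 u1] /= ->.
exists u1; split=> [|c] /=; first by rewrite pair2 subrr.
by rewrite pair2 => -[_] /eqP; rewrite subr_eq0 => /eqP ->.
Qed.

Lemma superdim_L520 : superdim (L520 K) 5 0.
Proof.
have sumE d (c : 'rV[K]_d) : \sum_i c ord0 i *: (delta_mx ord0 i : 'rV[K]_d) = c.
  exact: esym (row_sum_delta c).
split; last first.
  exists (fun=> 0); split=> [[]//|x /= ->]; exists 0; split=> [|c _].
    by rewrite /= big_ord0 subr0.
  by apply/rowP => -[].
exists (fun i => delta_mx ord0 i); split=> // x _; exists x; split=> [|c] /=.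
  by rewrite sumE subrr.
by rewrite sumE => /eqP; rewrite subr_eq0 => /eqP.
Qed.

End Isomorphisms.

(** * Classification *)

Section L520Recognition.
Variable K : numFieldType.
Local Notation crd := (fun (c : 'rV[K]_5) (i : nat) => c ord0 (inord i)).

Lemma L520_bracketE (c d : L520 K) : bracket (L520 K) c d =
  (crd c 0 * crd d 1 - crd c 1 * crd d 0) *: delta_mx ord0 (inord 3) +
  (crd c 0 * crd d 2 - crd c 2 * crd d 0) *: delta_mx ord0 (inord 4).
Proof. by []. Qed.

Lemma crd_bracket (c d : L520 K) i : (i < 5)%N -> crd (bracket (L520 K) c d) i =
  if i == 3 then crd c 0 * crd d 1 - crd c 1 * crd d 0 else
  if i == 4 then crd c 0 * crd d 2 - crd c 2 * crd d 0 else 0.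
Proof.
move=> hi; rewrite L520_bracketE !mxE -!val_eqE /= !inordK //.
by case: i hi => [|[|[|[|[|]]]]] //= _; rewrite ?mulr0 ?mulr1 ?addr0 ?add0r.
Qed.

Lemma row5P (c : 'rV[K]_5) : (forall i, (i < 5)%N -> crd c i = 0) -> c = 0.
Proof.
by move=> h; apply/rowP => j; rewrite mxE -[j]inord_val; apply: h.
Qed.

Lemma row5_delta (c : 'rV[K]_5) : c =
  crd c 0 *: delta_mx ord0 (inord 0) + crd c 1 *: delta_mx ord0 (inord 1) +
  crd c 2 *: delta_mx ord0 (inord 2) + crd c 3 *: delta_mx ord0 (inord 3) +
  crd c 4 *: delta_mx ord0 (inord 4).
Proof.
apply/eqP; rewrite -subr_eq0; apply/eqP/row5P => i hi.
rewrite !mxE -!val_eqE /= !inordK //.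
by case: i hi => [|[|[|[|[|]]]]] //= _; ring.
Qed.

Lemma bijective_injsurj (T U : Type) (f : T -> U) :
  injective f -> (forall y, exists x, f x = y) -> bijective f.
Proof.
by move=> finj /choice [g gK]; exists g => // x; apply: finj; rewrite gK.
Qed.

Variables (V : vectType K) (A : vectSuper V).
Local Notation "[ x , y ]" := (vbr A x y) (at level 0).

Lemma isomorphic_L520 : lie_nilpotent (super_of A) -> \dim (derived A) = 2 ->
  \dim (cocycles A 0%VS) = (\dim (skew_forms A (derived A)) +
    (\dim {:V} - \dim (derived A)) + 2 + \dim (derived A :&: vpar A true))%N ->
  isomorphic (L520 K) (super_of A).
Proof.
move=> nilA dimD dimZ.
have cen := derived_central nilA dimD dimZ; have skew := vbrC nilA dimD dimZ.
have even := all_even nilA dimD dimZ.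
have [x [y [w [yw v0 v'v span]]]] := L520_basis nilA dimD dimZ.
set v := [x, y] in v0 v'v span; set v' := [x, w] in v'v span.
have cenl u : [v, u] = 0 by apply/cen/vbr_derived.
have cenl' u : [v', u] = 0 by apply/cen/vbr_derived.
have cenr u : [u, v] = 0 by rewrite skew cenl oppr0.
have cenr' u : [u, v'] = 0 by rewrite skew cenl' oppr0.
have diag u : [u, u] = 0 by apply: vbr_even.
pose g (c : L520 K) : super_of A :=
  crd c 0 *: x + crd c 1 *: y + crd c 2 *: w + crd c 3 *: v + crd c 4 *: v'.
have gl : linear g.
  move=> a c d; rewrite /g !mxE !scalerDl -!scalerA !scalerDr.
  by do 4 (rewrite [RHS]addrACA; congr (_ + _)).
have xg d : [x, g d] = crd d 1 *: v + crd d 2 *: v'.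
  by rewrite /g !vbrDr !vbrZr diag cenr cenr' !scaler0 !addr0 add0r.
have yg d : [y, g d] = - (crd d 0 *: v).
  rewrite /g !vbrDr !vbrZr diag cenr cenr' yw !scaler0 !addr0.
  by rewrite skew -/v scalerN.
have wy : [w, y] = 0 by rewrite skew yw oppr0.
have wg d : [w, g d] = - (crd d 0 *: v').
  rewrite /g !vbrDr !vbrZr diag cenr cenr' wy !scaler0 !addr0.
  by rewrite skew -/v' scalerN.
have gb c d : g (bracket (L520 K) c d) = [g c, g d].
  rewrite {2}/g !vbrDl !vbrZl xg yg wg cenl cenl' !scaler0 !addr0.
  rewrite /g !crd_bracket //= !scale0r !add0r scalerDr !scalerN !scalerA !scalerBl.
  by rewrite [LHS]addrACA -[RHS]addrA.
have indep a b : a *: v + b *: v' = 0 -> a = 0 /\ b = 0.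
  move=> h; have b0 : b = 0.
    apply: contraNeq v'v => b0; apply/vlineP; exists (- (b^-1 * a)).
    apply: (scalerI b0); rewrite scalerA mulrN mulrA mulfV // mul1r scaleNr.
    by apply/eqP; rewrite -addr_eq0 addrC h.
  split=> //; move: h; rewrite b0 scale0r addr0 => /eqP.
  by rewrite scaler_eq0 (negbTE v0) orbF => /eqP.
have ginj : injective g.
  move=> c d /eqP; rewrite -subr_eq0 -(linB gl) => /eqP h.
  apply/eqP; rewrite -subr_eq0; apply/eqP/row5P; move: (c - d : L520 K) h => {c d} c h.
  (* Bracketing with [x] isolates the coordinates 1 and 2, bracketing with [y] the coordinate 0; a
     combination of the independent [v] and [v'] remains. *)
  have [c1 c2] : crd c 1 = 0 /\ crd c 2 = 0 by apply: indep; rewrite -xg h vbr0r.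
  have c0 : crd c 0 = 0.
    have := yg c; rewrite h vbr0r => /esym/eqP; rewrite oppr_eq0 scaler_eq0.
    by rewrite (negbTE v0) orbF => /eqP.
  have [c3 c4] : crd c 3 = 0 /\ crd c 4 = 0.
    by apply: indep; move: h; rewrite /g c0 c1 c2 !scale0r !add0r.
  by case=> [|[|[|[|[|]]]]].
exists g; split; last first.
  apply: bijective_injsurj => // u; have [a [b [c [d [e uE]]]]] := span u.
  exists (\row_j nth 0 [:: a; b; c; d; e] j).
  by rewrite /g !mxE !inordK //= uE.
split=> //; split=> // -[] c hc; last exact: even.
by rewrite (hc : c = 0) (lin0 gl); apply: mem0v.
Qed.

Lemma L520_dims : isomorphic (L520 K) (super_of A) ->
  [/\ \dim (derived A) = 2, vpar A true = 0%VS &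
      \dim {:V} = 5 -> (8 <= \dim (cocycles A 0%VS))%N].
Proof.
move=> [f [[fl [fc fb]] [h fK hK]]]; have [hl hc] := graded_inverse fl fc fK hK.
have {}fl : linear (f : 'rV[K]_5 -> V) := fl.
have odd0 : vpar A true = 0%VS.
  apply/eqP; rewrite -subv0; apply/subvP => u hu; rewrite memv0 -[u]hK.
  by have -> : h u = 0 := hc true u hu; rewrite (lin0 fl).
have [b bE] : exists b : nat -> V, forall i, b i = f (delta_mx ord0 (inord i)).
  by exists (fun i => f (delta_mx ord0 (inord i))).
have fE c : f c = crd c 0 *: b 0 + crd c 1 *: b 1 + crd c 2 *: b 2 +
    crd c 3 *: b 3 + crd c 4 *: b 4.
  by rewrite {1}[c]row5_delta !(linD fl) !(linZ fl) !bE.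
have fbE c d : [f c, f d] = (crd c 0 * crd d 1 - crd c 1 * crd d 0) *: b 3 +
    (crd c 0 * crd d 2 - crd c 2 * crd d 0) *: b 4.
  by rewrite -[LHS]fb L520_bracketE (linD fl) !(linZ fl) !bE.
have bb i : (i < 3)%N -> (0 < i)%N -> [b 0, b i] = b i.+2.
  move=> i3 i0; rewrite [b 0]bE [b i]bE fbE !mxE -!val_eqE /= !inordK ?(ltn_trans i3) //.
  by case: i i3 i0 => [|[|[|]]] //= _ _; rewrite !mulr0 !mulr1 !subr0 !scale0r !scale1r ?addr0 ?add0r.
have b30 : b 3 != 0.
  apply/eqP => /(congr1 h); rewrite bE fK -(lin0 fl) fK => /rowP /(_ (inord 3)).
  by rewrite !mxE !eqxx => /eqP; rewrite oner_eq0.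
have b43 : b 4 \notin <[b 3]>%VS.
  apply/negP => /vlineP [t]; rewrite !bE -(linZ fl) => /(congr1 h).
  rewrite !fK => /rowP /(_ (inord 4)); rewrite !mxE -!val_eqE /= !inordK //=.
  by rewrite mulr0 => /eqP; rewrite oner_eq0.
have DE : derived A = (<[b 3]> + <[b 4]>)%VS.
  apply/eqP; rewrite eqEsubv; apply/andP; split; last first.
    by rewrite subv_add -!memvE -(bb 1%N) // -(bb 2%N) // !vbr_derived.
  apply/subvP.
  apply: derived_ind => [|u t]; first exact: vspace_subspace.
  rewrite -(hK u) -(hK t) fbE /=; apply: memv_add; apply: memvZ; exact: memv_line.
split=> //; first by rewrite DE dim_addline // dim_vline b30.
move=> dimV.
(* These are the cocycle identities at [b 0, b 1, b 4] and at [b 0, b 1, b 2]. They imply all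
   others, so at least 10 - 2 dimensions remain. *)
pose t (g : 'Hom(V, 'Hom(V, K^o))) (i : 'I_2) : K :=
  if i == 0 then fval g (b 3) (b 4) else fval g (b 1) (b 4) - fval g (b 2) (b 3).
have tl a g g' i : t (a *: g + g') i = a * t g i + t g' i.
  by rewrite /t; case: ifP => _; rewrite !fval_lin //; ring.
have [T hT] : exists T : 'Hom('Hom(V, 'Hom(V, K^o)), 'rV[K]_2), forall g, T g =
    \row_i t g i.
  by apply: lfun_exists => a g g'; apply/rowP => i; rewrite mxE tl !mxE.
have g0 : graded A 0%VS by move=> e u; rewrite memv0 => /eqP ->; rewrite linear0 mem0v.
have dimS : \dim (skew_forms A 0%VS) = 10.
  by rewrite dim_skew_forms // dimv0 subn0 dimV /odd_codim odd0 dimv0.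
have sub : (skew_forms A 0 :&: lker T <= cocycles A 0)%VS.
  apply/subvP => g /memv_capP [/skew_formsP [sg vg]]; rewrite memv_ker hT => /eqP/rowP Tg.
  have g34 : fval g (b 3) (b 4) = 0 by have := Tg 0; rewrite !mxE.
  have g23 : fval g (b 1) (b 4) = fval g (b 2) (b 3).
    by apply/eqP; rewrite -subr_eq0; have := Tg 1; rewrite !mxE /t /= => ->.
  apply/cocyclesP; split=> //.
  have even x : x \in vpar A false.
    by have := memvf x; rewrite -(vpar_span A) odd0 addv0.
  have sk x y : fval g x y = - fval g y x.
    by rewrite (sg false false) // mul1r.
  have alt x : fval g x x = 0 := skew_even sg (even x).
  have jac x y z : fval g x [y, z] = fval g [x, y] z + fval g y [x, z].
    have e3 c : fval g (f c) (b 3) = crd c 0 * fval g (b 0) (b 3) +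
        crd c 1 * fval g (b 1) (b 3) + crd c 2 * fval g (b 2) (b 3).
      rewrite fE !fvalDl !fvalZl alt [fval g (b 4) (b 3)]sk g34.
      by rewrite oppr0 !mulr0 !addr0.
    have e4 c : fval g (f c) (b 4) = crd c 0 * fval g (b 0) (b 4) +
        crd c 1 * fval g (b 2) (b 3) + crd c 2 * fval g (b 2) (b 4).
      by rewrite fE !fvalDl !fvalZl alt g34 g23 !mulr0 !addr0.
    have e c d d' : fval g (f c) [f d, f d'] =
        (crd d 0 * crd d' 1 - crd d 1 * crd d' 0) * fval g (f c) (b 3) +
        (crd d 0 * crd d' 2 - crd d 2 * crd d' 0) * fval g (f c) (b 4).
      by rewrite fbE fvalDr !fvalZr.
    rewrite [fval g [x, y] z]sk -(hK x) -(hK y) -(hK z) !e !e3 !e4.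
    move: (fval g (b 0) (b 3)) (fval g (b 1) (b 3)) (fval g (b 2) (b 3)).
    move: (fval g (b 0) (b 4)) (fval g (b 2) (b 4)) => *; ring.
  move=> [] [] x y z hx hy; rewrite ?mul1r //; try exact: jac.
  move: hx hy; rewrite odd0 !memv0 => /eqP -> /eqP ->.
  by rewrite !vbr0l !fval0l mulr0 addr0.
have := limg_ker_dim T (skew_forms A 0); have := dimvS sub.
have : (\dim (T @: skew_forms A 0) <= 2)%N.
  by apply: leq_trans (dimvS (subvf _)) _; rewrite dimvf /dim /= mul1n.
rewrite dimS; dimlia.
Qed.

End L520Recognition.

Lemma bin2_double p : ('C(p, 2) * 2 + p = p * p)%N.
Proof. by elim: p => // p IHp; rewrite binS bin1; nia. Qed.

Lemma bin2D a b : ('C(a + b, 2) = 'C(a, 2) + a * b + 'C(b, 2))%N.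
Proof.
have := bin2_double (a + b); have := bin2_double a; have := bin2_double b.
by nia.
Qed.

(** For [m + n = p.+1] the quadratic term is ['C(p, 2)]. The case [m + n = 0] stays apart, as the
    quadratic term is 1 there. *)
Lemma s_invariant_eq1 (K : numFieldType) (L : lieSuper K) m n p : (m + n = p.+1)%N ->
  s_invariant L m n = 1 <-> multiplier_dim L = ('C(p, 2) + n)%N.
Proof.
move=> mn; rewrite /s_invariant mn; set d := multiplier_dim L.
have h : 'C(p, 2)%:R * 2 + p%:R = p%:R * p%:R :> rat.
  by rewrite -natrM -natrD bin2_double natrM.
have e : 2^-1 * (p.+1%:R - 2) * (p.+1%:R - 1) = 'C(p, 2)%:R :> rat.
  rewrite -[p.+1]addn1 natrD; apply: (mulIf (x := 2)) => //.
  by rewrite -[RHS](addrK p%:R) h; field.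
rewrite e; split=> [s1|->]; last by rewrite natrD; ring.
apply/eqP; rewrite -(eqr_nat rat) natrD; apply/eqP; lra.
Qed.

(** * Case distinction on the dimension of the derived subalgebra *)

Section Main.
Variables (K : numFieldType) (V : vectType K) (A : vectSuper V).
Hypothesis nilA : lie_nilpotent (super_of A).
Local Notation D := (derived A).
Local Notation N := (\dim {:V}).
Local Notation n := (\dim (vpar A true)).

Let graded0 : graded A 0%VS.
Proof. by move=> b x; rewrite memv0 => /eqP ->; rewrite linear0 mem0v. Qed.

Let derived0 : D = 0%VS -> forall x y, vbr A x y = 0.
Proof. by move=> D0 x y; apply/eqP; rewrite -memv0 -D0 vbr_derived. Qed.

Lemma dim_cocycles_abelian : D = 0%VS -> \dim (cocycles A 0%VS) = ('C(N, 2) + n)%N.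
Proof.
move=> D0; rewrite -{1}D0 -skew_forms_derived D0 dim_skew_forms //.
by rewrite dimv0 subn0 /odd_codim cap0v dimv0 subn0.
Qed.

(** The dichotomy jumps over this value. Its first case gives at most ['C(N.-1, 2) + n], because an
    odd [z] adds one to the bound but lowers [odd_codim] by one; its second case gives
    ['C(N.-1, 2) + n + 2]. *)
Lemma derived_dim1 : \dim D = 1%N -> \dim (cocycles A 0%VS) != ('C(N.-1, 2) + n + 1)%N.
Proof.
move=> D1; have nsub : ~~ (D <= 0)%VS.
  by apply: contraPN D1 => /dimvS; rewrite dimv0; dimlia.
have [b [z [hz zD zI zc]]] := nilpotent_chain nilA nsub.
have DE : D = (0 + <[z]>)%VS by apply: addline_eqEdim; rewrite ?sub0v ?D1 ?dimv0.
have [phi [phiI phiP phiz]] := homogeneous_functional graded0 hz zI.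
have hD u y : u \in D -> vbr A u y \in 0%VS.
  rewrite DE; apply: addline_ideal hz zc _ _ => u' y'; rewrite memv0 => /eqP ->.
  by rewrite vbr0l mem0v.
have o : \dim (D :&: vpar A true) = b.
  by rewrite DE (dim_addline_odd graded0 hz zI) cap0v dimv0.
have le : (\dim (D :&: vpar A true) <= n)%N by rewrite dimvS ?capvSr.
have := dim_skew_forms (@derived_graded _ _ A); rewrite /odd_codim D1 subn1.
have [h|[bE _ h]] := dim_cocycles_dichotomy graded0 hz DE hD phiI phiP phiz.
  by move: h o le; case: (b) => /=; dimlia.
by move: h o le; rewrite bE /=; dimlia.
Qed.

Lemma derived_dim2 : \dim D = 2 -> \dim (cocycles A 0%VS) = ('C(N.-1, 2) + n + 2)%N ->
  isomorphic (L520 K) (super_of A).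
Proof.
move=> D2 hZ; apply: isomorphic_L520 => //; rewrite hZ dim_skew_forms; last exact: derived_graded.
have le : (\dim (D :&: vpar A true) <= n)%N by rewrite dimvS ?capvSr.
have leD := dimvS (subvf D); rewrite D2 in leD *.
have -> : N.-1 = (N - 2).+1 by move: leD; dimlia.
rewrite binS bin1 /odd_codim; move: le; move: (N - 2)%N => k; dimlia.
Qed.

Lemma derived_dim3 k : \dim D = k.+3 -> (\dim (cocycles A 0%VS) < 'C(N.-1, 2) + n + k.+3)%N.
Proof.
move=> Dk; have leD := dimvS (subvf D).
have hI u y : u \in 0%VS -> vbr A u y \in 0%VS.
  by rewrite memv0 => /eqP ->; rewrite vbr0l mem0v.
have D0 : \dim D = (\dim (0%VS : {vspace V}) + k.+3)%N by rewrite dimv0 Dk.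
have := dim_cocycles_le nilA graded0 hI (sub0v D) D0.
rewrite dim_skew_forms; last exact: derived_graded.
have le : (odd_codim A D <= n)%N by rewrite leq_subr.
rewrite Dk in leD *; set a := (N - k.+3)%N.
have -> : N.-1 = (a + k.+2)%N by rewrite /a; move: leD; dimlia.
rewrite bin2D [in X in _ -> (_ < X)%N]binS bin1; move: (odd_codim A D) le => o le.
move: (\dim (cocycles A 0%VS)) => c; move: 'C(a, 2) 'C(k.+1, 2) => r s; move: (n) le.
by clear=> n0 le h; nia.
Qed.

Lemma multiplier_classification m n' : superdim (super_of A) m n' ->
  s_invariant (super_of A) m n' = 1 <->
  (isomorphic (super_of A) (L520 K) \/
   isomorphic (super_of A) (abelian_super K 1 0) \/
   isomorphic (super_of A) (abelian_super K 0 1)).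
Proof.
move=> hdim; have [dm dn] := superdim_super_of hdim.
have dN : N = (m + n')%N.
  by rewrite -(vpar_span A) dimv_disjoint_sum ?vpar_cap // dm dn.
have hM := multiplier_dim_cocycles A.
split=> [s1|].
  case p1 : (m + n')%N => [|p].
    (* For the zero superalgebra the formula gives s = 2. *)
    have Z0 : \dim (cocycles A 0%VS) = 0%N.
      apply/eqP; rewrite dimv_eq0 -subv0; apply/subvP => g _; rewrite memv0.
      apply/eqP/lfunP => x; suff -> : x = 0 by rewrite !linear0.
      by apply/eqP; rewrite -memv0; have := memvf x;
        have /eqP -> : {:V}%VS == 0%VS by rewrite -dimv_eq0 dN p1.
    have M0 : multiplier_dim (super_of A) = 0%N by move: hM Z0; dimlia.
    move: s1; rewrite /s_invariant p1 M0; have -> : n' = 0%N by lia.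
    by move=> /eqP.
  move: s1; rewrite (s_invariant_eq1 _ p1) => Mp; rewrite Mp in hM.
  case Dk : (\dim D) => [|[|[|k]]].
  - have D0 : D = 0%VS by apply/eqP; rewrite -dimv_eq0 Dk.
    have := dim_cocycles_abelian D0; rewrite -hM Dk dN p1 dn addn0 binS bin1 => hp.
    have {hp} p0 : p = 0%N by move: hp; move: 'C(p, 2) => c; lia.
    have iso := isomorphic_abelian hdim (derived0 D0); right.
    have [[mE nE]|[mE nE]] : (m = 1 /\ n' = 0)%N \/ (m = 0 /\ n' = 1)%N by lia.
      by left; rewrite mE nE in iso.
    by right; rewrite mE nE in iso.
  - by have := derived_dim1 Dk; rewrite -hM Dk dN p1 dn eqxx.
  - left; apply: isomorphic_sym; apply: derived_dim2 => //.
    by rewrite -hM Dk dN p1 dn.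
  - by have := derived_dim3 Dk; rewrite -hM Dk dN p1 dn ltnn.
have abel k l : isomorphic (super_of A) (abelian_super K k l) ->
    [/\ m = k, n' = l & multiplier_dim (super_of A) = ('C(k + l, 2) + l)%N].
  move=> iso; have isoS := isomorphic_sym iso.
  have [dk dl] := superdim_super_of (superdim_iso isoS (superdim_abelian K k l)).
  have D0 : D = 0%VS.
    apply/eqP; rewrite -subv0; apply/subvP; apply: derived_ind => [|x y].
      exact: vspace_subspace.
    have [g [[gl [_ gb]] [h gK _]]] := iso.
    suff -> : vbr A x y = 0 by rewrite /= mem0v.
    by apply: (can_inj gK); rewrite -[vbr A x y]/(bracket (super_of A) x y) gb (lin0 gl).
  split; [by rewrite -dm | by rewrite -dn |].
  by move: hM; rewrite dim_cocycles_abelian // D0 dimv0 addn0 dN -dm -dn dk dl.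
case=> [iso|[] /abel [-> -> M]].
2,3: by apply/(s_invariant_eq1 _ (p := 0)).
have isoS := isomorphic_sym iso.
have [d5 d0] := superdim_super_of (superdim_iso isoS (superdim_L520 K)).
have m5 : m = 5 by rewrite -dm. have n0 : n' = 0%N by rewrite -dn.
have N5 : N = 5 by rewrite dN m5 n0.
have [D2 odd0 /(_ N5) ge8] := L520_dims isoS.
(* The general bound 3 + 2 + 3 meets the lower bound of [L520_dims], so the multiplier has dimension
   8 - 2 = 6. *)
have le8 : (\dim (cocycles A 0%VS) <= 8)%N.
  have hI u y : u \in 0%VS -> vbr A u y \in 0%VS.
    by rewrite memv0 => /eqP ->; rewrite vbr0l mem0v.
  have D0 : \dim D = (\dim (0%VS : {vspace V}) + 2)%N by rewrite dimv0 D2.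
  have := dim_cocycles_le nilA graded0 hI (sub0v D) D0.
  rewrite dim_skew_forms; last exact: derived_graded.
  by rewrite /odd_codim odd0 D2 N5 dimv0 sub0n.
rewrite m5 n0; apply/(s_invariant_eq1 _ (p := 4)) => //.
by move: hM ge8 le8; rewrite D2 (_ : 'C(4, 2) = 6) //; dimlia.
Qed.

End Main.

Theorem theorem1p2_numField (K : numFieldType) (L : lieSuper K) (m n : nat)
    (hdim : superdim L m n) (hnil : lie_nilpotent L) :
  s_invariant L m n = 1 <->
  (isomorphic L (L520 K) \/
   isomorphic L (abelian_super K 1 0) \/
   isomorphic L (abelian_super K 0 1)).
Proof.
have [V [A iso]] := superdim_model hdim; have isoS := isomorphic_sym iso.
have := multiplier_classification (nilpotent_iso iso hnil) (superdim_iso iso hdim).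
rewrite /s_invariant -(multiplier_dim_iso iso) => ->.
have tr M : isomorphic (super_of A) M <-> isomorphic L M.
  by split; [exact: isomorphic_trans | exact: isomorphic_trans].
by rewrite !tr.
Qed.

Local Open Scope complex_scope.

Theorem theorem1p2 (R : realType) (L : lieSuper R[i]) (m n : nat)
    (hdim : superdim L m n) (hnil : lie_nilpotent L) :
  s_invariant L m n = 1 <->
  (isomorphic L (L520 R[i]) \/
   isomorphic L (abelian_super R[i] 1 0) \/
   isomorphic L (abelian_super R[i] 0 1)).
Proof. exact: theorem1p2_numField hdim hnil. Qed.
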